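(* Let $\{Y\backslash Q_1,\ldots,Q_k\}$ be an $(n+1)$-dimensional face-simple manifold with exceptional facets, let $\lambda$ be a $\mathbb{Z}_2$-isotropy function on it, let $\eta:E\to Y$ be a principal $\mathbb{Z}_2^n$-bundle, and let $W(Y,\lambda,\eta)$ be the associated quotient space $E/\!\sim_b$. Then $W(Y,\lambda,\eta)$ is an $(n+1)$-dimensional $\mathbb{Z}_2^n$-manifold with boundary, and its boundary is a disjoint union of $2$-torus manifolds.
   Context: $\mathbb{Z}_2=\mathbb{Z}/2\mathbb{Z}$. A $2$-torus manifold of dimension $n$ is a closed smooth $n$-manifold with an effective action of $\mathbb{Z}_2^n$. Manifolds with corners. An $n$-dimensional manifold with corners is a Hausdorff space $Q\subset\mathbb{R}^m$ each point of which has a neighborhood homeomorphic to an open subset of $\mathbb{R}^n_{\ge 0}$, preserving the codimension function. Codimension-one faces are called facets, $0$-dimensional faces are called vertices; $V(\cdot)$ denotes the set of vertices. All manifolds with corners are assumed nice (each codimension-$2$ face is a connected component of the intersection of a unique collection of two facets). Face-simple manifolds. An $(n+1)$-dimensional compact manifold with corners $Y$ is face-simple with exceptional facets $Q_1,\ldots,Q_k$, written $\{Y\backslash Q_1,\ldots,Q_k\}$, if: (1) $Q_1,\ldots,Q_k$ are facets of $Y$ with $Q_i\cap Q_j=\emptyset$ for $i\ne j$; (2) $V(Y)=\bigcup_{i=1}^kV(Q_i)$; (3) any codimension-$\ell$ face of $Y$ is a connected component of the intersection of a unique collection of $\ell$ facets. The remaining facets $F_1,\ldots,F_m$ of $Y$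 are called the facets of $\{Y\backslash Q_1,\ldots,Q_k\}$. $\mathbb{Z}_2$-isotropy function. A function $\lambda:\{F_1,\ldots,F_m\}\to\mathbb{Z}_2^n$ such that $\{\lambda(F_{i_1}),\ldots,\lambda(F_{i_\ell})\}$ is part of a basis of $\mathbb{Z}_2^n$ whenever $F_{i_1}\cap\cdots\cap F_{i_\ell}\neq\emptyset$. Write $\lambda_i=\lambda(F_i)$. The space $W(Y,\lambda,\eta)$. For a face $F$ of $Y$ of codimension $\ell>0$, let $M(F)\subseteq\mathbb{Z}_2^n$ be the subgroup generated by all $\lambda_i$ with $F_i$ among the unique $\ell$ facets of $Y$ of whose intersection $F$ is a connected component (an exceptional facet $Q_j$ among these contributes nothing); $M(Y)$ and $M(Q_i)$ are trivial. On $E$ put $x\sim_b y$ if and only if $\eta(x)=\eta(y)$ and $x=ty$ for some $t\in M(F)$, where $F$ is the unique face of $Y$ containing $\eta(y)$ in its relative interior. Then $W(Y,\lambda,\eta)=E/\!\sim_b$, with the $\mathbb{Z}_2^n$-action induced from that on $E$.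
   Formalization: The boundary pieces are shown to be smooth 2-torus manifolds when Y is a smooth manifold with corners; for merely topological Y they are topological 2-torus manifolds (the smooth claim fails there, e.g. for Y = X×[0,1] with X a non-smoothable closed 4-manifold). *)

(* Defs.v *)
From HB Require Import structures.
From mathcomp Require Import all_boot all_order all_algebra all_fingroup.
From mathcomp Require Import generic_quotient all_classical all_reals all_analysis.
Import numFieldNormedType.Exports.
Import GRing.Theory.

Set Implicit Arguments.
Unset Strict Implicit.
Unset Printing Implicit Defensive.

Local Open Scope classical_set_scope.
Local Open Scope ring_scope.

Notation Z2 n := 'rV['F_2]_n.

(** ** Manifolds, with boundary or corners, as spaces with an atlas *)

(* [f] restricts to a homeomorphism from [A] onto [B] (subspace topologies);
   the last clause is the continuity of the inverse. *)
Definition homeo_on (X Z : topologicalType) (A : set X) (B : set Z)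
    (f : X -> Z) : Prop :=
  [/\ set_bij A B f, {within A, continuous f} &
      forall O : set X, open O ->
        exists2 O' : set Z, open O' & f @` (A `&` O) = B `&` O'].

(* The local model: [b = d] is the orthant R^d_{>=0} (manifolds with corners),
   [b = 1] a half-space (manifolds with boundary), [b = 0] is R^d. *)
Definition orthant (R : realType) (d b : nat) : set 'rV[R]_d :=
  [set x | forall i : 'I_d, (i < b)%N -> 0 <= x ord0 i].

Arguments orthant R d b : clear implicits.

Definition iterated_partial (R : realType) (d : nat) (s : seq 'I_d)
    (f : 'rV[R]_d -> R) : 'rV[R]_d -> R :=
  foldr (fun i g x => 'D_(delta_mx ord0 i) g x) f s.

Definition smooth_on (R : realType) (d e : nat) (V : set 'rV[R]_d)
    (g : 'rV[R]_d -> 'rV[R]_e) : Prop :=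
  forall (j : 'I_e) (s : seq 'I_d) (x : 'rV[R]_d), V x ->
    let h := iterated_partial s (fun y => g y ord0 j) in
    {for x, continuous h} /\ forall i, derivable h x (delta_mx ord0 i).

Record chart (R : realType) (X : topologicalType) (d : nat) := Chart {
  chart_dom : set X;
  chart_map :> X -> 'rV[R]_d }.

Definition is_chart (R : realType) (X : topologicalType) (d b : nat)
    (c : chart R X d) : Prop :=
  open (chart_dom c) /\
  exists2 V : set 'rV[R]_d, open V &
    homeo_on (chart_dom c) (V `&` orthant R d b) c.

(* The category in which the construction takes place. The boundary of W can
   only be smooth if Y is: for a non-smoothable closed manifold X, Y = X x [0,1]
   with exceptional facets X x {0} and X x {1} has copies of X as boundary of W.
   Hence all notions are parametrized, and [Smooth] 2-torus manifolds are
   obtained from smooth Y. *)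
Variant regularity := Topological | Smooth.

(* In the smooth case, [c' \o f \o c^-1] locally extends to a C^oo map between
   open subsets of Euclidean spaces. *)
Definition regular_in_charts (R : realType) (r : regularity)
    (X X' : topologicalType) (d d' : nat) (c : chart R X d) (c' : chart R X' d')
    (f : X -> X') : Prop :=
  match r with
  | Topological => True
  | Smooth => forall x, chart_dom c x -> chart_dom c' (f x) ->
      exists (V : set 'rV[R]_d) (g : 'rV[R]_d -> 'rV[R]_d'),
        [/\ open V, V (c x), smooth_on V g &
            forall y, chart_dom c y -> chart_dom c' (f y) -> V (c y) ->
              g (c y) = c' (f y)]
  end.

Definition regular_map (R : realType) (r : regularity) (X X' : topologicalType)
    (d d' : nat) (A : set (chart R X d)) (A' : set (chart R X' d'))
    (f : X -> X') : Prop :=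
  continuous f /\
  forall c c', A c -> A' c' -> regular_in_charts r c c' f.

Definition is_atlas (R : realType) (r : regularity) (X : topologicalType)
    (d b : nat) (A : set (chart R X d)) : Prop :=
  [/\ forall c, A c -> is_chart b c,
      forall x, exists2 c, A c & chart_dom c x &
      forall c c', A c -> A c' -> regular_in_charts r c c' idfun].

Definition manifold (R : realType) (r : regularity) (X : topologicalType)
    (d b : nat) (A : set (chart R X d)) : Prop :=
  [/\ hausdorff_space X, @second_countable X & is_atlas r b A].

Definition boundary (R : realType) (X : topologicalType) (n : nat)
    (A : set (chart R X n.+1)) : set X :=
  [set x | exists c, [/\ A c, chart_dom c x & c x ord0 ord0 = 0]].

(* The charts induced on a piece [B] of the boundary: forget the coordinate
   that vanishes there. *)
Definition boundary_chart (R : realType) (X : topologicalType) (n : nat)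
    (B : set X) (c : chart R X n.+1) : chart R (set_type B) n :=
  Chart [set x : set_type B | chart_dom c (set_val x)]
        (fun x : set_type B => col' ord0 (c (set_val x))).

Definition boundary_atlas (R : realType) (X : topologicalType) (n : nat)
    (B : set X) (A : set (chart R X n.+1)) : set (chart R (set_type B) n) :=
  @boundary_chart R X n B @` A.
Arguments boundary_atlas {R X n} B A.

(** ** Actions of Z_2^n *)

Definition is_action (n : nat) (X : Type) (act : Z2 n -> X -> X) : Prop :=
  (forall x, act 0 x = x) /\ (forall s t x, act (s + t) x = act s (act t x)).

Definition effective (n : nat) (X : Type) (act : Z2 n -> X -> X) : Prop :=
  forall t, (forall x, act t x = x) -> t = 0.

Definition regular_action (R : realType) (r : regularity) (n d : nat)
    (X : topologicalType) (A : set (chart R X d)) (act : Z2 n -> X -> X) : Prop :=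
  is_action act /\ forall t, regular_map r A A (act t).

Definition Z2n_manifold_with_boundary (R : realType) (r : regularity)
    (n d : nat) (X : topologicalType) (A : set (chart R X d))
    (act : Z2 n -> X -> X) : Prop :=
  manifold r 1 A /\ regular_action r A act.

Definition two_torus_manifold (R : realType) (r : regularity) (n : nat)
    (X : topologicalType) (A : set (chart R X n)) (act : Z2 n -> X -> X) : Prop :=
  [/\ manifold r 0 A, compact [set: X], regular_action r A act & effective act].

(** ** Manifolds with corners and face-simple manifolds *)

Definition num_zeros (R : realType) (d : nat) (x : 'rV[R]_d) : nat :=
  #|[set i | x ord0 i == 0]|.

(* [cod] is the codimension function. *)
Definition manifold_with_corners (R : realType) (r : regularity)
    (Y : topologicalType) (d : nat) (A : set (chart R Y d)) (cod : Y -> nat)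
    : Prop :=
  [/\ hausdorff_space Y,
      exists (N : nat) (f : Y -> 'rV[R]_N), homeo_on setT (range f) f,
      is_atlas r d A &
      forall c y, A c -> chart_dom c y -> cod y = num_zeros (c y)].

Section Faces.
Context {Y : topologicalType} (cod : Y -> nat).
Implicit Types (G : set Y) (S : set (set Y)).

(* The face containing [y] in its relative interior: the closure of the
   component of [y] in the set of points having the same codimension. *)
Definition face_at (y : Y) : set Y :=
  closure (connected_component [set z | cod z = cod y] y).

Definition face (l : nat) G : Prop := exists2 y, cod y = l & G = face_at y.

Definition facet G : Prop := face 1 G.

Definition vertices (d : nat) G : set (set Y) :=
  [set v | face d v /\ v `<=` G].

Definition component_of (B G : set Y) : Prop :=
  exists2 y, B y & G = connected_component B y.

Definition facet_collection (l : nat) G S : Prop :=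
  [/\ S `<=` facet, (S #= `I_l)%card & component_of (\bigcap_(H in S) H) G].

End Faces.

Definition face_simple (R : realType) (r : regularity) (n k m : nat)
    (Y : topologicalType) (A : set (chart R Y n.+1)) (cod : Y -> nat)
    (Q : 'I_k -> set Y) (F : 'I_m -> set Y) : Prop :=
  [/\ [/\ manifold_with_corners r A cod & compact [set: Y]],
      [/\ forall i, facet cod (Q i) & forall i j, i != j -> Q i `&` Q j = set0],
      vertices cod n.+1 setT = \bigcup_i vertices cod n.+1 (Q i),
      forall l G, face cod l G -> exists! S, facet_collection cod l G S &
      [/\ injective F & range F = facet cod `\` range Q]].

(* Repetitions among the [lam i] are not allowed on intersecting facets. *)
Definition isotropy_function (n m : nat) (Y : topologicalType)
    (F : 'I_m -> set Y) (lam : 'I_m -> Z2 n) : Prop :=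
  forall I : {set 'I_m}, (\bigcap_(i in [set` I]) F i) !=set0 ->
    exists s : seq (Z2 n), basis_of fullv ([seq lam i | i <- enum I] ++ s).

(** ** Principal bundles and the space W *)

Record principal_bundle (n : nat) (Y : topologicalType) := PrincipalBundle {
  total : topologicalType;
  proj :> total -> Y;
  tact : Z2 n -> total -> total;
  proj_continuous : continuous proj;
  tact_continuous : forall t, continuous (tact t);
  tact_action : is_action tact;
  proj_tact : forall t x, proj (tact t x) = proj x;
  local_triviality : forall y : Y, exists (U : set Y)
      (phi : total -> discrete_topology (Z2 n)),
    [/\ open U, U y,
        homeo_on (proj @^-1` U) (U `*` setT) (fun x => (proj x, phi x)) &
        forall t x, U (proj x) -> phi (tact t x) = t + (phi x : Z2 n)] }.

Section QuotientSpace.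
Context {n m : nat} {Y : topologicalType}.
Variables (cod : Y -> nat) (F : 'I_m -> set Y) (lam : 'I_m -> Z2 n).
Variable eta : principal_bundle n Y.
Local Notation E := (total eta).

Definition isotropy_subgroup (l : nat) (G : set Y) : {group Z2 n} :=
  <<[set lam i | i : 'I_m &
      `[< exists2 S, facet_collection cod l G S & S (F i) >]]>>%G.

Definition simb (x y : E) : bool :=
  `[< eta x = eta y /\
      exists2 t, t \in isotropy_subgroup (cod (eta y)) (face_at cod (eta y)) &
        x = tact t y >].

Lemma simb_equiv : equiv_class_of simb.
Proof.
have [act0 actD] := tact_action eta.
split=> [x|x y|y x z].
- by apply/asboolP; split=> //; exists 0; rewrite ?act0// group1.
- apply/asboolP/asboolP => -[exy [t Mt ->]]; split; rewrite ?proj_tact//.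
    exists (- t); last by rewrite -actD addNr act0.
    by rewrite (groupVr Mt).
  by exists (- t); [rewrite (groupVr Mt)|rewrite -actD addNr act0].
- move=> /asboolP[exy [s Ms ->]] /asboolP[eyz [t Mt ->]].
  apply/asboolP; split; first by rewrite !proj_tact.
  exists (s + t); last by rewrite actD.
  by apply: groupM => //; rewrite -eyz.
Qed.

Canonical simb_rel : equiv_rel E := EquivRelPack simb_equiv.

Definition W : topologicalType := quotient_topology {eq_quot simb_rel}%qT.

Definition W_pi (x : E) : W := (\pi_{eq_quot simb_rel} x)%qT.

Definition W_act (t : Z2 n) (w : W) : W := W_pi (tact t (repr w)).

Lemma W_piP x y : W_pi x = W_pi y <-> simb x y.
Proof. by split=> [/eqmodP|xy] //; apply/eqmodP. Qed.

Lemma W_actE t x : W_act t (W_pi x) = W_pi (tact t x).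
Proof.
have [_ actD] := tact_action eta.
have : simb (repr (W_pi x)) x by apply/W_piP; exact: reprK.
move=> /asboolP[exy [s Ms exs]]; apply/W_piP/asboolP; rewrite !proj_tact.
by split=> //; exists s; rewrite // exs -!actD addrC.
Qed.

End QuotientSpace.

(* Main.v *)
(* Near a point of Y, the quotient W is obtained by reflecting a corner across the
   walls that belong to nonexceptional facets: the isotropy vectors of these
   facets are independent, so a sheet of the bundle is indexed by the signs of the
   reflected coordinates. An exceptional facet is not reflected and becomes the
   boundary; since exceptional facets are disjoint, at most one coordinate is kept
   nonnegative, and W is locally a half-space.

   The smooth case needs no collars if the reflected coordinates are taken to be
   u_i with u_i ^ 2 = x_i, rather than u_i = +- x_i. A transition map x' of Y
   sends the wall x_i = 0 to the wall x'_j = 0, so by Hadamard's lemma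
   x'_j = x_i * h(x) with h smooth and positive, and u'_j = +- u_i * sqrt(h(u ^ 2))
   is smooth. *)
Require Import Defs.
From HB Require Import structures.
From mathcomp Require Import all_boot all_order all_algebra all_fingroup.
From mathcomp Require Import generic_quotient all_classical all_reals all_analysis.
From mathcomp Require Import ring lra.
Import Order.TTheory GRing.Theory Num.Theory numFieldNormedType.Exports.

Set Implicit Arguments.
Unset Strict Implicit.
Unset Printing Implicit Defensive.

Local Open Scope classical_set_scope.
Local Open Scope ring_scope.

(** * Smooth functions of several variables *)

(** Two conditions on the facets carry the local picture. A face of codimension l has a collection
    of l facets, and counting then forces distinct walls at a point into distinct facets, so that
    the independence of the isotropy vectors applies wall by wall. Every vertex lies on an
    exceptional facet, so at most n walls are reflected at any point and a coordinate is always left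
    over for the half-space.

    The signs are not functions on W: they come from a trivialization and from functionals dual to
    the isotropy vectors of one corner, and they are ambiguous on the walls. What descends to W is
    the product of the two signs that two charts attach to a common wall.

    Smoothness at a corner means local extension to an open set of Euclidean space, and the
    extensions supplied by Y are controlled only on the orthant. Vanishing and positivity are
    therefore established at points of Y, and positivity is then spread by continuity.

    The action needs no computation of its own: translating a trivialization by t turns the action
    of t into a change of charts. *)

Lemma nbhsI {X : topologicalType} (x : X) (P P' : set X) :
  nbhs x P -> nbhs x P' -> nbhs x (P `&` P').
Proof. exact: filterI. Qed.

Lemma near_eq_continuous {X Z : topologicalType} (f g : X -> Z) (x : X) :
  {near x, f =1 g} -> {for x, continuous f} -> {for x, continuous g}.
Proof.
move=> fg cf; have := cf; rewrite /prop_for /continuous_at.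
by rewrite -(nbhs_singleton fg); apply: cvg_trans; exact: near_eq_cvg.
Qed.

Section Ck.
Context {R : realType}.

Local Notation e_ i := (delta_mx ord0 i).

(* The innermost derivative is peeled off first, whereas [iterated_partial] adds
   derivatives outside. *)
Fixpoint Ck (N d : nat) (V : set 'rV[R]_d) (f : 'rV[R]_d -> R) : Prop :=
  (forall x, V x -> {for x, continuous f}) /\
  if N is N'.+1 then
    forall i, (forall x, V x -> derivable f x (e_ i)) /\
      Ck N' V (fun x => 'D_(e_ i) f x)
  else True.

Definition smooth (d : nat) (V : set 'rV[R]_d) (f : 'rV[R]_d -> R) : Prop :=
  forall N, Ck N V f.

Section Basic.
Context {d : nat} (V : set 'rV[R]_d).
Implicit Types (f g : 'rV[R]_d -> R) (x : 'rV[R]_d).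

Lemma Ck_continuous N f x : Ck N V f -> V x -> {for x, continuous f}.
Proof. by case: N => [|N] [cf _]; exact: cf. Qed.

Lemma CkS N f : Ck N.+1 V f -> Ck N V f.
Proof.
elim: N f => [|N IH] f [cf df]; first by split.
by split=> // i; have [dfi cfi] := df i; split=> //; exact: IH.
Qed.

Lemma iterated_partial_rcons (s : seq 'I_d) i f :
  iterated_partial (rcons s i) f = iterated_partial s (fun x => 'D_(e_ i) f x).
Proof. by rewrite /iterated_partial foldr_rcons. Qed.

(** The last index of the list is the derivative taken first, so induction from the end of the list
    matches the recursion of [Ck]. *)
Lemma smoothP f : smooth V f <->
  forall (s : seq 'I_d) x, V x ->
    let h := iterated_partial s f in
    {for x, continuous h} /\ forall i, derivable h x (e_ i).
Proof.
split.
- move=> Sf s; elim/last_ind: s f Sf => [|s i IH] f Sf x Vx h.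
    split; first exact: (Ck_continuous (Sf 0%N)).
    by move=> i; have [_ /(_ i)[+ _]] := Sf 1%N; exact.
  rewrite /h iterated_partial_rcons; apply: IH => // N.
  by have [_ /(_ i)[]] := Sf N.+1.
- move=> + N; elim: N f => [|N IH] f Hf.
    by split=> // x Vx; have [] := Hf [::] x Vx.
  split; first by move=> x Vx; have [] := Hf [::] x Vx.
  move=> i; split=> [x Vx|]; first by have [_] := Hf [::] x Vx; exact.
  apply: IH => s x Vx h; have := Hf (rcons s i) x Vx.
  by rewrite /h iterated_partial_rcons.
Qed.

Lemma CkW N (V' : set 'rV[R]_d) f : V' `<=` V -> Ck N V f -> Ck N V' f.
Proof.
move=> V'V; elim: N f => [|N IH] f [cf df]; split=> //; try by move=> x /V'V/cf.
move=> i; have [dfi cfi] := df i; split; last exact: IH.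
by move=> x /V'V; exact: dfi.
Qed.

Hypothesis oV : open V.

Lemma Ck_congr N f g : (forall x, V x -> f x = g x) -> Ck N V f -> Ck N V g.
Proof.
have nV x : V x -> nbhs x V by move=> Vx; exact: open_nbhs_nbhs.
elim: N f g => [|N IH] f g fg [cf df].
  by split=> // x Vx; apply: near_eq_continuous _ (cf _ Vx); exact: filterS (nV _ Vx).
split.
  by move=> x Vx; apply: near_eq_continuous _ (cf _ Vx); exact: filterS (nV _ Vx).
move=> i; have [dfi cfi] := df i; split.
  move=> x Vx; apply: near_eq_derivable (dfi _ Vx).
  by apply: filterS (nV _ Vx) => y Vy; rewrite fg.
apply: IH cfi => x Vx; apply: near_eq_derive.
by apply: filterS (nV _ Vx) => y Vy; rewrite fg.
Qed.

Lemma Ck_cst N (c : R) : Ck N V (fun=> c).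
Proof.
elim: N c => [|N IH] c; split=> //; try by move=> x _; exact: (@cst_continuous _ _ c).
move=> i; split=> [x _|]; first exact: derivable_cst.
by apply: Ck_congr (IH 0) => x _; rewrite derive_cst.
Qed.

Lemma CkD N f g : Ck N V f -> Ck N V g -> Ck N V (fun x => f x + g x).
Proof.
elim: N f g => [|N IH] f g [cf df] [cg dg].
  by split=> // x Vx; apply: (@continuousD _ _ _ f g); [exact: cf|exact: cg].
split=> [x Vx|i].
  by apply: (@continuousD _ _ _ f g); [exact: cf|exact: cg].
have [dfi cfi] := df i; have [dgi cgi] := dg i; split.
  by move=> x Vx; apply: (@derivableD _ _ _ f g); [exact: dfi|exact: dgi].
apply: Ck_congr (IH _ _ cfi cgi) => x Vx.
by rewrite -deriveD//; [exact: dfi|exact: dgi].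
Qed.

Lemma CkM N f g : Ck N V f -> Ck N V g -> Ck N V (fun x => f x * g x).
Proof.
elim: N f g => [|N IH] f g fN gN.
  by split=> // x Vx; apply: (@continuousM _ _ f g); [exact: fN.1|exact: gN.1].
have [[cf df] [cg dg]] := (fN, gN).
split=> [x Vx|i].
  by apply: (@continuousM _ _ f g); [exact: cf|exact: cg].
have [dfi cfi] := df i; have [dgi cgi] := dg i; split.
  by move=> x Vx; apply: (@derivableM _ _ f g); [exact: dfi|exact: dgi].
apply: Ck_congr (CkD (IH _ _ (CkS fN) cgi) (IH _ _ (CkS gN) cfi)) => x Vx.
by rewrite [RHS](@deriveM _ _ f g)//; [exact: dfi|exact: dgi].
Qed.

(** The derivative of the inverse contains the inverse again, but only to one order less; hence the
    induction is on the order with [f] fixed. The same holds for the square root below. *)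
Lemma Ck_inv N f : (forall x, V x -> f x != 0) -> Ck N V f ->
  Ck N V (fun x => (f x)^-1).
Proof.
move=> f0; elim: N => [|N IH] fN.
  by split=> // x Vx; apply: continuousV; [exact: f0|exact: fN.1].
have [cf df] := fN.
split=> [x Vx|i]; first by apply: continuousV; [exact: f0|exact: cf].
have [dfi cfi] := df i; split.
  by move=> x Vx; apply: derivableV; [exact: f0|exact: dfi].
have If := IH (CkS fN).
apply: Ck_congr (CkM (CkM (Ck_cst N (-1)) (CkM If If)) cfi) => x Vx.
rewrite deriveV; [|exact: f0|exact: dfi].
by rewrite scaleNr expr2 invfM mulN1r mulNr.
Qed.

(** Partial derivatives become derivatives of one real variable, so the chain rule on the line
    suffices and total differentiability never enters. *)
Lemma is_derive_lineP f x v (df : R) :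
  is_derive x v f df <-> is_derive (0 : R) 1 (fun h : R => f (h *: v + x)) df.
Proof.
have e : 'D_v f x = 'D_1 (fun h : R => f (h *: v + x)) 0.
  rewrite /derive; set g1 := fun h => h^-1 *: _; set g2 := fun h => h^-1 *: _.
  suff -> : g1 = g2 by [].
  by apply/funext => h; rewrite /g1 /g2 /= addr0 scale0r add0r [_%:A]mulr1.
split=> -[dfx <-]; (apply: DeriveDef; last by rewrite e).
  by move/derivable1P : dfx.
by apply/derivable1P.
Qed.

Lemma Ck_sqrt N f : (forall x, V x -> 0 < f x) -> Ck N V f ->
  Ck N V (fun x => Num.sqrt (f x)).
Proof.
move=> f0.
have cs x : V x -> {for x, continuous f} ->
    {for x, continuous (fun x => Num.sqrt (f x))}.
  by move=> Vx cf; apply: continuous_comp => //; exact: sqrt_continuous.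
elim: N => [|N IH] fN; first by split=> // x Vx; apply: cs => //; exact: fN.1.
have [cf df] := fN.
split=> [x Vx|i]; first by apply: cs => //; exact: cf.
have [dfi cfi] := df i.
have isd x : V x -> is_derive x (e_ i) (fun x => Num.sqrt (f x))
    ((2 * Num.sqrt (f x))^-1 * 'D_(e_ i) f x).
  move=> Vx; apply/is_derive_lineP.
  apply: (@is_derive1_comp _ Num.sqrt (fun h : R => f (h *: e_ i + x))).
    by rewrite scale0r add0r; apply: is_derive1_sqrt; exact: f0.
  by apply/is_derive_lineP/derivableP; exact: dfi.
split; first by move=> x /isd[].
have h0 x : V x -> 2 * Num.sqrt (f x) != 0.
  by move=> Vx; rewrite mulf_neq0 ?pnatr_eq0// gt_eqF// sqrtr_gt0 f0.
apply: Ck_congr (CkM (Ck_inv h0 (CkM (Ck_cst N 2) (IH (CkS fN)))) cfi) => x /isd.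
by move/@derive_val->.
Qed.

End Basic.

(** A substitution that moves along a single axis whenever one variable moves needs only the
    one-variable chain rule. Both substitutions used later have this shape: squaring and permuting
    coordinates, and inserting a zero coordinate. *)
Lemma Ck_comp (d d' N : nat) (V : set 'rV[R]_d) (V' : set 'rV[R]_d')
    (Phi : 'rV[R]_d' -> 'rV[R]_d) (k : 'I_d' -> 'I_d) (psi dpsi : 'I_d' -> R -> R)
    (f : 'rV[R]_d -> R) : open V' ->
  (forall u, V' u -> V (Phi u)) ->
  (forall u, V' u -> {for u, continuous Phi}) ->
  (forall j h u, Phi (h *: e_ j + u) =
     (psi j (h + u ord0 j) - psi j (u ord0 j)) *: e_ (k j) + Phi u) ->
  (forall j (x : R), is_derive x 1 (psi j) (dpsi j x)) ->
  (forall j, smooth V' (fun u => dpsi j (u ord0 j))) ->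
  Ck N V f -> Ck N V' (fun u => f (Phi u)).
Proof.
move=> oV' VPhi cPhi Phij dpsij Spsi.
have cf (g : 'rV[R]_d -> R) : (forall x, V x -> {for x, continuous g}) ->
    forall u, V' u -> {for u, continuous (fun u => g (Phi u))}.
  by move=> cg u V'u; apply: continuous_comp; [exact: cPhi|exact/cg/VPhi].
elim: N f => [|N IH] f [fc df]; first by split=> //; exact: cf.
split=> [|j]; first exact: cf.
have isd u : V' u -> is_derive u (e_ j) (fun u => f (Phi u))
   ('D_(e_ (k j)) f (Phi u) * dpsi j (u ord0 j)).
  move=> V'u; apply/is_derive_lineP.
  have -> : (fun h : R => f (Phi (h *: e_ j + u))) =
     (fun s => f (s *: e_ (k j) + Phi u)) \o
       (fun h => psi j (h + u ord0 j) - psi j (u ord0 j)).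
    by apply/funext => h /=; rewrite Phij.
  apply: is_derive1_comp; last first.
    apply: is_derive_eq (subr0 _); apply: is_deriveB.
    rewrite -[dpsi _ _]mulr1.
    apply: (@is_derive1_comp _ (psi j) (fun h : R => h + u ord0 j)).
      by rewrite add0r.
    by apply: is_derive_eq (addr0 _); apply: is_deriveD.
  rewrite add0r subrr; apply/is_derive_lineP/derivableP.
  by have [+ _] := df (k j); apply; exact: VPhi.
split; first by move=> u /isd[].
have [_ dk] := df (k j).
by apply: Ck_congr (CkM oV' (IH _ dk) (Spsi j N)) => // u /isd/@derive_val->.
Qed.

Lemma smooth_coord (d : nat) (V : set 'rV[R]_d) i : open V ->
  smooth V (fun x => x ord0 i).
Proof.
move=> oV [|N]; first by split=> // x _; exact: coord_continuous.
have D x j : is_derive x (e_ j) (fun x : 'rV[R]_d => x ord0 i) (i == j)%:R.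
  apply/is_derive_lineP.
  have -> : (fun h : R => (h *: e_ j + x) ord0 i) =
     (fun h => h * (i == j)%:R + x ord0 i).
    by apply/funext => h; rewrite !mxE eqxx.
  apply: is_derive_eq (addr0 _); apply: is_deriveD.
  have M := @is_deriveM R R id (cst (i == j)%:R) 0 1 1 0
    (is_derive_id _ _) (is_derive_cst _ _ _).
  by apply: is_derive_eq M _; rewrite /= scaler0 add0r [_%:A]mulr1.
split=> [x _|j]; first exact: coord_continuous.
split; first by move=> x _; have [] := D x j.
by apply: Ck_congr (Ck_cst oV N (i == j)%:R) => // x _; have [_ ->] := D x j.
Qed.

End Ck.
(** * Hadamard's lemma *)

Lemma continuous_unit_integrable {R : realType} (g : R -> R) :
  (forall s, 0 <= s <= 1 -> {for s, continuous g}) ->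
  (@lebesgue_measure R).-integrable `[0, 1] (EFin \o g).
Proof.
move=> cg; apply: continuous_compact_integrable; first exact: segment_compact.
by apply: continuous_in_subspaceT => s; rewrite inE/= in_itv/=; exact: cg.
Qed.

Section Hadamard.
Context {R : realType} {d : nat} (i0 : 'I_d) (V : set 'rV[R]_d).
Local Notation e_ i := (delta_mx ord0 i).
Local Notation mu := (@lebesgue_measure R).
Hypothesis oV : open V.
Implicit Types (f : 'rV[R]_d -> R) (x : 'rV[R]_d).

(** Multiplication of the coordinate [i0] by [s], written as a displacement along one axis so that
    [is_derive_lineP] applies to it. *)
Definition shrink (s : R) (x : 'rV[R]_d) : 'rV[R]_d :=
  ((s - 1) * x ord0 i0) *: e_ i0 + x.

Hypothesis Vshrink : forall (s : R) x, 0 <= s <= 1 -> V x -> V (shrink s x).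

Lemma shrink_continuous (s : R) (x : 'rV[R]_d) :
  shrink z.1 z.2 @[z --> (s, x)] --> shrink s x.
Proof.
apply: cvgD; last exact: cvg_snd.
apply: cvgZr_tmp; apply: cvgM.
  by apply: cvgB; [exact: cvg_fst|exact: cvg_cst].
apply: (@cvg_comp _ _ _ snd (fun y : 'rV[R]_d => y ord0 i0) _ (nbhs x)).
  exact: cvg_snd.
exact: coord_continuous.
Qed.

(** The Hadamard quotient is the case [a = 0] applied to a partial derivative. Each derivative in
    direction [i0] brings out a further factor [s], and the exponent keeps the family closed under
    differentiation. *)
Definition shrink_avg (a : nat) (f : 'rV[R]_d -> R) (x : 'rV[R]_d) : R :=
  \int[mu]_(s in `[0, 1]) (s ^+ a * f (shrink s x)).

(** The tube lemma: continuity at each point of the segment becomes uniform in [s] because the unit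
    interval is compact. *)
Lemma shrink_uniform f x (eps : R) : (forall x, V x -> {for x, continuous f}) ->
  V x -> 0 < eps ->
  \forall y \near x, `[0, 1] `<=` [set s : R | `|f (shrink s x) - f (shrink s y)| < eps].
Proof.
move=> cf Vx e0.
have /compact_near_coveringP H := @segment_compact R 0 1.
apply: (H _ (nbhs x) (fun y s => `|f (shrink s x) - f (shrink s y)| < eps)) => s s01.
have Vs : V (shrink s x) by apply: Vshrink.
have cfs : f (shrink z.1 z.2) @[z --> (s, x)] --> f (shrink s x).
  apply: (@cvg_comp _ _ _ (fun z => shrink z.1 z.2) f _ (nbhs (shrink s x))).
    exact: shrink_continuous.
  exact: cf.
have e20 : 0 < eps / 2 by rewrite divr_gt0.
have /cvgrPdist_lt/(_ _ e20) H1 := cfs.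
have [[A B]/= [As Bx] AB] := H1.
exists (A, B) => // -[s' y] /= [As' By].
have h1 := AB (s', y) (conj As' By).
have h2 := AB (s', x) (conj As' (nbhs_singleton Bx)).
rewrite /= in h1 h2.
rewrite -(subrKA (f (shrink s x))) (splitr eps).
by rewrite (le_lt_trans (ler_normD _ _))// ltrD// distrC.
Qed.

Lemma shrink_continuousl f x (s : R) : (forall x, V x -> {for x, continuous f}) ->
  V x -> 0 <= s <= 1 -> {for s, continuous (fun s => f (shrink s x))}.
Proof.
move=> cf Vx s01; apply: (@cvg_comp _ _ _ _ f _ (nbhs (shrink s x))).
  apply: cvgD; last exact: cvg_cst.
  apply: cvgZr_tmp; apply: cvgM; last exact: cvg_cst.
  by apply: cvgB; [exact: cvg_id|exact: cvg_cst].
by apply: cf; exact: Vshrink.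
Qed.

Lemma shrink_weight_continuous a f x (s : R) :
  (forall x, V x -> {for x, continuous f}) -> V x -> 0 <= s <= 1 ->
  {for s, continuous (fun s : R => s ^+ a * f (shrink s x))}.
Proof.
move=> cf Vx s01; apply: cvgM; first exact: exprn_continuous.
exact: shrink_continuousl.
Qed.

Lemma shrink_integrable a f x : (forall x, V x -> {for x, continuous f}) -> V x ->
  mu.-integrable `[0, 1] (EFin \o (fun s => s ^+ a * f (shrink s x))).
Proof.
move=> cf Vx; apply: continuous_unit_integrable => s s01.
exact: shrink_weight_continuous.
Qed.

Lemma shrink_avg_continuous a f x : (forall x, V x -> {for x, continuous f}) ->
  V x -> {for x, continuous (shrink_avg a f)}.
Proof.
move=> cf Vx; apply/(@cvgrPdist_le _ _ _ (nbhs x)) => eps e0.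
have nV : nbhs x V by exact: open_nbhs_nbhs.
have := shrink_uniform cf Vx e0; move/filterI => /(_ _ nV).
apply: filterS => y [ys Vy].
rewrite /shrink_avg -RintegralB//; [|exact: shrink_integrable..].
apply: le_trans (le_normr_Rintegral _ _) _ => //.
  apply: continuous_unit_integrable => s s01.
  by apply: cvgB; exact: shrink_weight_continuous.
have -> : eps = \int[mu]_(s in `[0, 1]) eps.
  rewrite Rintegral_cst//.
  rewrite [X in fine X](_ : _ = 1%E) ?mulr1//.
  by have := lebesgue_measure_itv `[(0 : R), 1]; rewrite /= lte_fin ltr01 oppr0 adde0.
apply: le_Rintegral => //.
- apply: continuous_unit_integrable => s s01.
  by apply: cvg_norm; apply: cvgB; exact: shrink_weight_continuous.
- by apply: continuous_unit_integrable => s _; exact: cvg_cst.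
- move=> s s01; rewrite -mulrBr normrM.
  move: (s01); rewrite /= in_itv/= => /andP[s0 s1].
  rewrite (le_trans _ (ltW (ys _ s01)))// ler_piMl// ger0_norm ?exprn_ge0//.
  exact: exprn_ile1.
Qed.

Lemma shrink_line (s t : R) x j :
  shrink s (t *: e_ j + x) = (t * s ^+ (j == i0)) *: e_ j + shrink s x.
Proof.
apply/rowP => i; rewrite !mxE eqxx/=.
by have [->|ji] := eqVneq j i0; rewrite ?eqxx ?(eq_sym i0) ?(negbTE ji);
   rewrite ?expr1 ?expr0/= ?[_ == j]eq_sym; case: eqP => _ /=; ring.
Qed.

Lemma shrink_bounded f x : (forall x, V x -> {for x, continuous f}) -> V x ->
  exists M : R, forall s, 0 <= s <= 1 -> `|f (shrink s x)| <= M.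
Proof.
move=> cf Vx.
have [|c _ H] := @EVT_max R (fun s => `|f (shrink s x)|) 0 1 ler01.
  apply: continuous_in_subspaceT => s; rewrite inE/= in_itv/= => s01.
  by apply: cvg_norm; exact: shrink_continuousl.
by exists `|f (shrink c x)| => s s01; apply: H; rewrite in_itv.
Qed.

(** Differentiation under the integral sign. A displacement [t] of [x] along axis [j] displaces the
    shrunk point by [t * s] if [j = i0] and by [t] otherwise, whence the new exponent. *)
Lemma shrink_avg_derive a f x j : Ck 1 V f -> V x ->
  is_derive x (e_ j) (shrink_avg a f)
    (shrink_avg (a + (j == i0)) (fun x => 'D_(e_ j) f x) x).
Proof.
move=> [cf /(_ j)[df [cdf _]]] Vx.
set D := fun x => 'D_(e_ j) f x.
have [M HM] := shrink_bounded cdf Vx.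
have nV : nbhs x V by exact: open_nbhs_nbhs.
(* The tolerance 1 makes [M + 1] a dominating constant for the derivatives, uniform in small
   displacements. *)
have HU := shrink_uniform cdf Vx ltr01.
have cl : (fun t : R => t *: (e_ j : 'rV[R]_d) + x) @ (0 : R) --> 0 *: e_ j + x.
  by apply: cvgD; [apply: cvgZr_tmp; exact: cvg_id|exact: cvg_cst].
rewrite scale0r add0r in cl.
have /cl[del /= del0 Hdel] : nbhs x ((fun y : 'rV[R]_d => `[0, 1] `<=`
    [set s | `|D (shrink s x) - D (shrink s y)| < 1]) `&` V) by exact: filterI.
have Hd (t : R) : `](- del), del[%classic t ->
    (forall s, 0 <= s <= 1 -> `|D (shrink s (t *: e_ j + x))| <= M + 1) /\
    V (t *: e_ j + x).
  rewrite /= in_itv/= -ltr_norml => td.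
  have [|H1 H2] := Hdel t; first by rewrite /= sub0r normrN.
  split=> // s s01; have := H1 s; rewrite /= in_itv/= => /(_ s01) /ltW H3.
  rewrite -[D _](subKr (D (shrink s x))) (le_trans (ler_normB _ _))//.
  by rewrite lerD// HM.
apply/is_derive_lineP.
pose g (t s : R) := s ^+ a * f (shrink s (t *: e_ j + x)).
pose g' (t s : R) := s ^+ (a + (j == i0)) * D (shrink s (t *: e_ j + x)).
have dg (t s : R) : `](- del), del[%classic t -> `[0, 1]%classic s ->
    is_derive t 1 (g ^~ s) (g' t s).
  move=> /Hd[_ Vt]; rewrite /= in_itv/= => s01.
  pose y := shrink s (t *: e_ j + x); pose w := s ^+ (j == i0).
  have Vy : V y by exact: Vshrink.
  have -> : g ^~ s = s ^+ a *: ((fun h : R => f (h *: e_ j + y)) \o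
      (fun t' => (t' - t) * w)).
    apply/funext => t' /=; rewrite /g /y; congr (_ * f _).
    by rewrite !shrink_line -/w [RHS]addrA -scalerDl -mulrDl subrK.
  have -> : g' t s = s ^+ a *: (D y * w).
    by rewrite /g' exprD /w -mulrA [X in _ * X]mulrC.
  apply: is_deriveZ; apply: is_derive1_comp.
    by rewrite subrr mul0r; apply/is_derive_lineP/derivableP/df.
  have Md := @is_deriveM R R (fun t' => t' - t) (cst w) t 1 1 0 _
    (is_derive_cst _ _ _).
  apply: is_derive_eq (Md _) _; last by rewrite /= scaler0 add0r [_%:A]mulr1.
  apply: is_derive_eq (subr0 _).
have d0 : `](- del), del[%classic (0 : R) by rewrite /= in_itv/= oppr_lt0 del0.
have ig (t : R) : `](- del), del[%classic t -> mu.-integrable `[0, 1] (EFin \o g t).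
  by move=> /Hd[_ Vt]; apply: shrink_integrable.
have derg (t s : R) : `](- del), del[%classic t -> `[0, 1]%classic s -> derivable (g ^~ s) t 1.
  by move=> It Is; have [] := dg t s It Is.
have M0 : 0 <= M + 1.
  by rewrite addr_ge0// (le_trans _ (HM 0 _))// ler01 lexx.
have iG : mu.-integrable `[0, 1] (EFin \o (fun=> M + 1)).
  by apply: continuous_unit_integrable => s _; exact: cvg_cst.
have ubG (t s : R) : `](- del), del[%classic t -> `[0, 1]%classic s ->
    `|partial1of2 g t s| <= M + 1.
  move=> It Is; rewrite partial1of2E; have [_ ->] := dg t s It Is.
  have [H1 _] := Hd _ It; move: Is; rewrite /= in_itv/= => s01.
  rewrite /g' normrM (le_trans _ (H1 s s01))// ler_piMl//.
  have /andP[s0 s1] := s01.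
  by rewrite ger0_norm ?exprn_ge0// exprn_ile1.
have F1 := @derivable_under_integral R _ _ mu g `[0, 1]%classic (measurable_itv _) _ _ _
  d0 ig derg _ (fun=> M0) iG ubG.
have F2 := @differentiation_under_integral R _ _ mu g `[0, 1]%classic (measurable_itv _) _ _ _
  d0 ig derg _ (fun=> M0) iG ubG.
have Fe : (fun h : R => shrink_avg a f (h *: e_ j + x)) =
  (fun x' : R => \int[mu]_(y in `[0, 1]) g x' y) by [].
apply: DeriveDef.
  by rewrite Fe.
rewrite Fe -derive1E F2.
rewrite /shrink_avg; apply: eq_Rintegral => s; rewrite inE => Is.
rewrite partial1of2E; have [_ ->] := dg 0 s d0 Is.
by rewrite /g' scale0r add0r.
Qed.

Lemma smooth_partial f j : smooth V f -> smooth V (fun x => 'D_(e_ j) f x).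
Proof. by move=> Sf N; have [_ /(_ j)[]] := Sf N.+1. Qed.

Lemma smooth_shrink_avg a f : smooth V f -> smooth V (shrink_avg a f).
Proof.
move=> Sf N; elim: N a f Sf => [|N IH] a f Sf.
  by split=> // x Vx; apply: shrink_avg_continuous => //; exact: (Sf 0%N).1.
split=> [x Vx|j]; first by apply: shrink_avg_continuous => //; exact: (Sf 0%N).1.
split=> [x Vx|]; first by have [] := shrink_avg_derive a j (Sf 1%N) Vx.
apply: Ck_congr (IH (a + (j == i0))%N _ (smooth_partial j Sf)) => // x Vx.
by have [_ ->] := shrink_avg_derive a j (Sf 1%N) Vx.
Qed.

(** The fundamental theorem of calculus along [s]: the derivative of [f (shrink s x)] is the partial
    derivative at the shrunk point times the constant [x ord0 i0], which comes out of the
    integral. *)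
Lemma hadamard f : smooth V f -> exists2 h, smooth V h &
  forall x, V x -> f x = f (shrink 0 x) + x ord0 i0 * h x.
Proof.
move=> Sf; exists (shrink_avg 0 (fun x => 'D_(e_ i0) f x)).
  exact/smooth_shrink_avg/smooth_partial.
move=> x Vx; pose D x := 'D_(e_ i0) f x.
have cf := (Sf 0%N).1.
have cD : forall x, V x -> {for x, continuous D} := (smooth_partial i0 Sf 0%N).1.
have dG (s : R) : 0 <= s <= 1 ->
    is_derive s 1 (fun s => f (shrink s x)) (D (shrink s x) * x ord0 i0).
  move=> s01; pose y := shrink s x; have Vy : V y by exact: Vshrink.
  have -> : (fun s => f (shrink s x)) = (fun h : R => f (h *: e_ i0 + y)) \o
      (fun s' => (s' - s) * x ord0 i0).
    apply/funext => s' /=; congr f.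
    rewrite /y /shrink [RHS]addrA -scalerDl -mulrDl; congr (_ *: _ + _).
    by congr (_ * _); ring.
  apply: is_derive1_comp.
    rewrite subrr mul0r; apply/is_derive_lineP/derivableP.
    by have [_ /(_ i0)[+ _]] := Sf 1%N; exact.
  have Md := @is_deriveM R R (fun t' => t' - s) (cst (x ord0 i0)) s 1 1 0 _
    (is_derive_cst _ _ _).
  apply: is_derive_eq (Md _) _; last by rewrite /= scaler0 add0r [_%:A]mulr1.
  exact: is_derive_eq (subr0 _).
have cG (s : R) : 0 <= s <= 1 -> {for s, continuous (fun s => f (shrink s x))}.
  exact: shrink_continuousl.
have ftc := @continuous_FTC2 R (fun s => D (shrink s x) * x ord0 i0)
  (fun s => f (shrink s x)) 0 1 ltr01.
have shrink1 : shrink 1 x = x by rewrite /shrink subrr mul0r scale0r add0r.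
have -> : f x = f (shrink 0 x) + \int[mu]_(s in `[0, 1]) (D (shrink s x) * x ord0 i0).
  rewrite /Rintegral ftc; first by rewrite shrink1 -EFinB /= [RHS]addrC subrK.
  - apply: continuous_in_subspaceT => s; rewrite inE/= in_itv/= => s01.
    by apply: cvgM; [exact: shrink_continuousl|exact: cvg_cst].
  - split.
    + by move=> s; rewrite in_itv/= => /andP[s0 s1]; have [] := dG s; rewrite ?ltW.
    + by apply: cvg_at_right_filter; apply: cG; rewrite lexx ler01.
    + by apply: cvg_at_left_filter; apply: cG; rewrite lexx ler01.
  - move=> s; rewrite in_itv/= => /andP[s0 s1]; rewrite derive1E.
    by have [] := dG s; rewrite ?ltW.
congr (_ + _); rewrite /shrink_avg.
rewrite -RintegralZl//; last exact: (@shrink_integrable 0 D x cD Vx).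
by apply: eq_Rintegral => s _; rewrite expr0 mul1r mulrC.
Qed.

End Hadamard.
(** * Charts *)

Section ChartSpec.
Context {R : realType}.

Lemma cvg_rV {T : Type} (G : set_system T) {FG : Filter G} (d : nat)
    (f : T -> 'rV[R]_d) (l : 'rV[R]_d) :
  (forall i, (fun x => f x ord0 i) @ G --> l ord0 i) -> f @ G --> l.
Proof.
move=> H A [P lP PA]; rewrite nbhs_filterE in PA *.
have : \forall x \near G, forall i, P ord0 i (f x ord0 i).
  apply: filter_forall => i; exact: (H i _ (lP ord0 i)).
rewrite /fmap; apply: filterS => x Hx; apply: PA => i j.
by rewrite (ord1 i).
Qed.

Lemma continuous_rV {X : topologicalType} (d : nat)
    (f : X -> 'rV[R]_d) (x : X) :
  (forall i, (fun y => f y ord0 i) @ x --> f x ord0 i) -> {for x, continuous f}.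
Proof. exact: (@cvg_rV X (nbhs x)). Qed.

Section OneChart.
Context {X : topologicalType} {d : nat} (b : nat) (c : chart R X d).

(** The subspace topologies of [homeo_on] are unpacked here once. The last clause, openness onto the
    image relative to the orthant, is the one that produces points with prescribed coordinates. *)
Definition chart_spec :=
  [/\ open (chart_dom c),
      forall x, chart_dom c x -> orthant R d b (c x),
      {in chart_dom c &, injective c},
      forall x, chart_dom c x -> {for x, continuous c} &
      forall x N, chart_dom c x -> nbhs x N ->
        \forall z \near c x, orthant R d b z ->
          exists y, [/\ N y, chart_dom c y & c y = z]].

Lemma is_chartP : is_chart b c <-> chart_spec.
Proof.
split=> [[oD [V oV [[cm ci cs] cc co]]]|[oD cm ci cc cl]].
  split=> //.
  - by move=> x Dx; have [_] := cm x Dx.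
  - move=> x Dx.
    by move: cc; rewrite continuous_open_subspace// => /(_ x); rewrite inE; exact.
  - move=> x N Dx Nx; have oN := open_interior N.
    have [P oP eP] := co _ oN.
    have : (V `&` orthant R d b `&` P) (c x).
      by rewrite -eP; exists x => //; split.
    move=> [[Vc _] Pc].
    have : nbhs (c x) (V `&` P).
      by apply: open_nbhs_nbhs; split => //; exact: openI.
    apply: filterS => z [Vz Pz] oz.
    have : (V `&` orthant R d b `&` P) z by [].
    rewrite -eP => -[y [Dy Ny] <-]; exists y; split=> //.
    exact: interior_subset Ny.
pose im (O : set X) : set 'rV[R]_d := interior [set z | orthant R d b z ->
  exists y, [/\ O y, chart_dom c y & c y = z]].
have imP O : open O -> c @` (chart_dom c `&` O) = im O `&` orthant R d b.
  move=> oO; apply/seteqP; split=> [_ [x [Dx Ox] <-]|z [/interior_subset Iz oz]].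
    by split; [apply: cl => //; exact: open_nbhs_nbhs|exact: cm].
  by have [y [Oy Dy <-]] := Iz oz; exists y.
split=> //; exists (im setT); first exact: open_interior.
split.
- split=> //.
  + move=> x Dx; rewrite -imP; last exact: openT.
    by exists x.
  + move=> z; rewrite -imP; last exact: openT.
    by move=> [x [Dx _] <-]; exists x.
- by rewrite continuous_open_subspace// => x; rewrite inE; exact: cc.
- move=> O oO; exists (im O); first exact: open_interior.
  rewrite imP//; apply/seteqP; split=> [z [Iz oz]|z [[_ oz] Iz]]; split=> //.
  split=> //; apply: filterS Iz => z' H /H[y [_ Dy e]]; exists y; split=> //.
Qed.

End OneChart.
End ChartSpec.

(** * Countable bases *)

Section Countability.
Context {R : realType}.

Lemma second_countableP (X : topologicalType) : @second_countable X <->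
  exists (B : nat -> set X), (forall i, open (B i)) /\
    forall x N, nbhs x N -> exists i, B i x /\ B i `<=` N.
Proof.
split=> [[B cB [oB bB]]|[B [oB bB]]].
  have /countable_injP[f finj] := cB.
  (* At most one member of the base has code [i]; the union yields the empty set when there is
     none. *)
  exists (fun i => \bigcup_(U in [set U | B U /\ f U = i]) U); split.
    by move=> i; apply: bigcup_open => U [/oB].
  move=> x N /bB[U [BU Ux] UN]; exists (f U); split; first by exists U.
  move=> y [U' [BU' e] U'y]; apply: UN; rewrite /= -(finj U' U)// inE//.
exists (range B); first exact: card_image_le.
split; first by move=> _ [i _ <-].
move=> x N /bB[i [Bx BN]]; by exists (B i).
Qed.

Lemma rV_second_countable d : @second_countable 'rV[R]_d.
Proof.
pose T : countType := ('rV[rat]_d * nat)%type.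
pose bb (t : T) : set 'rV[R]_d := ball (map_mx ratr t.1 : 'rV[R]_d) t.2.+1%:R^-1.
apply/second_countableP.
exists (fun i => if unpickle i is Some t then bb t else set0).
split=> [i|x N].
  case: unpickle => [t|]; last exact: open0.
  by apply: ball_open; rewrite invr_gt0.
move=> /nbhs_ballP[e /= e0 xN].
have [k ke] : exists k : nat, k.+1%:R^-1 < e / 2.
  have e20 : 0 < e / 2 by rewrite divr_gt0.
  exists (Num.truncn (e / 2)^-1); rewrite invf_plt ?posrE//.
  exact: truncnS_gt.
have H (i : 'I_d) : exists q : rat, `|ratr q - x ord0 i| < k.+1%:R^-1.
  have : x ord0 i - k.+1%:R^-1 < x ord0 i + k.+1%:R^-1 :> R.
    by rewrite ltrD2l gtrN// invr_gt0.
  move=> /rat_in_itvoo[q]; rewrite in_itv/= => /andP[q1 q2].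
  by exists q; rewrite ltr_distl q1 q2.
have [q Hq] := choice H.
pose t : T := (\row_i q i, k).
have bt : bb t x.
  by split=> [|i j]; rewrite ?invr_gt0// !mxE (ord1 i); exact: Hq.
exists (pickle t); rewrite pickleK; split=> //.
move=> y by_; apply: xN; apply: (@le_ball _ _ x (k.+1%:R^-1 + k.+1%:R^-1)).
  by rewrite (splitr e) lerD// ltW.
by apply: ball_triangle by_; exact: ball_sym.
Qed.

(** The base consists of preimages of basic open sets under the charts. Injectivity of a chart turns
    the local lifting of points into inclusion in the given neighborhood. *)
Lemma atlas_second_countable (X : topologicalType) (d b : nat)
    (c : nat -> chart R X d) :
  (forall i, is_chart b (c i)) -> (forall x, exists i, chart_dom (c i) x) ->
  @second_countable X.
Proof.
move=> cc cX.
have [B [oB bB]] := (second_countableP _).1 (rV_second_countable d).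
pose bb (p : nat * nat) := chart_dom (c p.1) `&` (c p.1) @^-1` B p.2.
apply/second_countableP.
exists (fun i => if unpickle i is Some p then bb p else set0); split=> [i|x N xN].
  case: unpickle => [[i' j]|]; last exact: open0.
  have /is_chartP[oD _ _ cD _] := cc i'.
  rewrite openE => x [/= Dx Bx]; apply: filterI; first exact: open_nbhs_nbhs.
  by apply: cD => //; exact: open_nbhs_nbhs.
have [i Dx] := cX x.
have /is_chartP[oD om ci cD cl] := cc i.
have [j [Bx BN]] := bB _ _ (cl x N Dx xN).
exists (pickle (i, j)); rewrite pickleK; split=> //.
move=> y [/= Dy By]; have [y' [Ny' Dy' e]] := BN _ By (om _ Dy).
by rewrite -(ci y' y)// inE.
Qed.

End Countability.
(** * Facets in the charts of a manifold with corners *)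

Section Segments.
Context {R : realType} {Y : topologicalType} {d : nat}.

Lemma segment_orthant (x z : 'rV[R]_d) (t : R) : 0 <= t <= 1 ->
  orthant R d d x -> orthant R d d z -> orthant R d d (x + t *: (z - x)).
Proof.
move=> /andP[t0 t1] ox oz i id; rewrite !mxE.
have := mulr_ge0 t0 (oz i id).
have : 0 <= (1 - t) * x ord0 i by rewrite mulr_ge0 ?ox// subr_ge0.
lra.
Qed.

(** The inverse of a chart is not given as a function, so a path is built by choosing preimages; its
    continuity is the last clause of [chart_spec]. *)
Lemma chart_segment (c : chart R Y d) (y y' : Y) (S : set Y) :
  chart_spec d c -> S `<=` chart_dom c ->
  (forall t : R, 0 <= t <= 1 -> exists2 z, S z & c z = c y + t *: (c y' - c y)) ->
  (forall z, S z -> exists2 t : R, 0 <= t <= 1 & c z = c y + t *: (c y' - c y)) ->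
  connected S.
Proof.
move=> [oD om ci cD cl] SD HS SH.
pose l (t : R) := c y + t *: (c y' - c y).
pose g t := xget y [set z | S z /\ c z = l t].
have gP t : 0 <= t <= 1 -> S (g t) /\ c (g t) = l t.
  move=> /HS[z Sz cz]; rewrite /g; by case: xgetP => [? -> //|/(_ z)[]].
have -> : S = g @` `[0, 1].
  apply/seteqP; split=> [z Sz|_ [t t01 <-]]; last first.
    by move: t01; rewrite /= in_itv/= => /gP[].
  have [t t01 cz] := SH _ Sz; exists t; first by rewrite /= in_itv.
  have [Sg cg] := gP t t01; apply: ci; rewrite ?inE; [exact: SD..|].
  by rewrite cg cz.
apply: connected_continuous_connected; first exact: segment_connected.
apply/subspace_continuousP => t; rewrite /= in_itv/= => t01.
have [Sg cg] := gP t t01.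
move=> N gN; rewrite nbhs_filterE /fmap/= /within/=.
have lt : l @ t --> l t.
  by apply: cvgD; [exact: cvg_cst|apply: cvgZr_tmp; exact: cvg_id].
have := cl _ _ (SD _ Sg) gN; rewrite cg => /lt.
apply: (@filterS _ (nbhs t)) => t' H /=; rewrite in_itv/= => t'01.
have [Sg' cg'] := gP t' t'01.
have [|z [Nz Dz cz]] := H; first by rewrite -cg'; exact/om/SD.
have zg : z = g t' by apply: ci; rewrite ?inE//; [exact: SD|rewrite cg' cz].
by have : N (g t') by rewrite -zg.
Qed.

End Segments.

Lemma ball_rVP {R : realType} {d : nat} (x z : 'rV[R]_d) (e : R) :
  ball x e z <-> 0 < e /\ forall i, `|x ord0 i - z ord0 i| < e.
Proof.
by split=> -[e0 H]; split=> // i; [exact: H|move=> j; rewrite (ord1 i); exact: H].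
Qed.

Lemma num_zerosE {R : realType} {d : nat} (x : 'rV[R]_d) :
  num_zeros x = #|[set i | x ord0 i == 0]%SET|.
Proof.
by apply: eq_card => i; rewrite !inE; apply/asboolP/idP.
Qed.

Section Corners.
Context {R : realType} {Y : topologicalType} {d : nat} (cod : Y -> nat).
Context (c : chart R Y d) (p : 'rV[R]_d) (eps : R) (U : set Y).
Hypothesis cc : chart_spec d c.
Hypothesis codE : forall y, chart_dom c y -> cod y = num_zeros (c y).
Hypothesis oU : open U.
Hypothesis Uc : U `<=` chart_dom c.
Hypothesis UB : forall y, U y -> ball p eps (c y).
Hypothesis BU : forall z : 'rV[R]_d, ball p eps z -> orthant R d d z ->
  exists2 y, U y & c y = z.
Hypothesis op : orthant R d d p.
Hypothesis eps0 : 0 < eps.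
Hypothesis Bpos : forall (z : 'rV[R]_d) i, ball p eps z -> 0 < p ord0 i -> 0 < z ord0 i.

Definition on_wall (i : 'I_d) (y : Y) := forall j, (c y ord0 j == 0) = (j == i).

Lemma wall_cod i y : U y -> on_wall i y -> cod y = 1%N.
Proof.
move=> Uy wy; rewrite codE//; last exact: Uc.
rewrite num_zerosE; apply: etrans (cards1 i); apply: eq_card => j.
by rewrite !inE wy.
Qed.

Lemma cod1_wall y : U y -> cod y = 1%N -> exists2 i, on_wall i y & p ord0 i = 0.
Proof.
move=> Uy; rewrite codE//; last exact: Uc.
rewrite num_zerosE => /eqP/cards1P[i /setP H]; exists i => [j|].
  by have := H j; rewrite !inE.
have := H i; rewrite !inE eqxx => /eqP ci0.
apply/eqP; rewrite eq_le op// andbT leNgt; apply/negP => /(Bpos (UB Uy)).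
by rewrite ci0 ltxx.
Qed.

Lemma ball_segment (x z : 'rV[R]_d) (t : R) : 0 <= t <= 1 ->
  ball p eps x -> ball p eps z -> ball p eps (x + t *: (z - x)).
Proof.
move=> /andP[t0 t1] /ball_rVP[_ bx] /ball_rVP[_ bz]; apply/ball_rVP; split=> // i.
rewrite !mxE.
have -> : p ord0 i - (x ord0 i + t * (z ord0 i - x ord0 i)) =
  (1 - t) * (p ord0 i - x ord0 i) + t * (p ord0 i - z ord0 i) by ring.
have t10 : 0 <= 1 - t by rewrite subr_ge0.
rewrite (le_lt_trans (ler_normD _ _))// !normrM (ger0_norm t0) (ger0_norm t10).
have [->|tn0] := eqVneq t 0; first by rewrite subr0 mul1r mul0r addr0.
have -> : eps = (1 - t) * eps + t * eps by ring.
by rewrite ler_ltD ?ler_wpM2l// ?ltW ?ltr_pM2l// lt_neqAle eq_sym tn0.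
Qed.

(** Ball and orthant are convex, and on the segment between the two points the i-th coordinate stays
    zero and the others positive. So within [U] a wall meets a single component of the points of
    codimension 1. *)
Lemma wall_component i y y' : U y -> U y' -> on_wall i y -> on_wall i y' ->
  connected_component [set z | cod z = 1%N] y y'.
Proof.
move=> Uy Uy' wy wy'.
pose S := [set z | U z /\
  exists2 t : R, 0 <= t <= 1 & c z = c y + t *: (c y' - c y)].
have [_ om _ _ _] := cc.
have oy := om _ (Uc Uy); have oy' := om _ (Uc Uy').
have Sy : S y by split=> //; exists 0; rewrite ?lexx ?ler01// scale0r addr0.
have Sy' : S y'.
  by split=> //; exists 1; rewrite ?lexx ?ler01// scale1r addrC subrK.
have cS : connected S.
  apply: (@chart_segment _ _ _ c y y') => // [z [/Uc]//|t t01|z []//].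
  have [||z Uz cz] := @BU (c y + t *: (c y' - c y) : 'rV[R]_d).
  - by apply: ball_segment => //; exact: UB.
  - exact: segment_orthant.
  - by exists z => //; split=> //; exists t.
exists S => //; split=> // z [Uz [t /andP[t0 t1] cz]] /=.
apply: (@wall_cod i) => // j; rewrite cz !mxE.
have [->|ji] := eqVneq j i.
  have /eqP -> : c y ord0 i == 0 by rewrite wy.
  have /eqP -> : c y' ord0 i == 0 by rewrite wy'.
  by rewrite subr0 mulr0 addr0 eqxx.
apply/negbTE; rewrite gt_eqF//.
have a0 : 0 < c y ord0 j by rewrite lt_neqAle eq_sym wy ji oy.
have b0 : 0 < c y' ord0 j by rewrite lt_neqAle eq_sym wy' ji oy'.
have -> : c y ord0 j + t * (c y' ord0 j - c y ord0 j) =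
  (1 - t) * c y ord0 j + t * c y' ord0 j by ring.
have [->|tn0] := eqVneq t 0; first by rewrite subr0 mul1r mul0r addr0.
by rewrite ltr_wpDl ?mulr_ge0 ?subr_ge0 ?(ltW a0)// mulr_gt0// lt_neqAle eq_sym tn0.
Qed.

Lemma wall_near i y N : U y -> c y ord0 i = 0 -> nbhs y N ->
  exists y', [/\ N y', U y' & on_wall i y'].
Proof.
move=> Uy ciy Ny; have [_ om _ _ cl] := cc.
have NUy : nbhs y (N `&` U) by apply: filterI => //; exact: open_nbhs_nbhs.
have := cl _ _ (Uc Uy) NUy => /nbhs_ballP[e /= e0 H].
(* Raising every coordinate but the i-th stays in the orthant and leaves the i-th as the only
   zero. *)
pose z : 'rV[R]_d := \row_j (c y ord0 j + (e / 2) * (j != i)%:R).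
have oz : orthant R d d z.
  move=> j _; rewrite mxE addr_ge0 ?om ?mulr_ge0//; first exact: Uc.
  by rewrite ltW// divr_gt0.
have [|y' [[Ny' Uy'] _ cy']] := H z _ oz.
  apply/ball_rVP; split=> // j; rewrite mxE opprD addrA subrr sub0r normrN.
  rewrite ger0_norm ?mulr_ge0//; last by rewrite ltW// divr_gt0.
  by case: (j != i); rewrite ?mulr1 ?mulr0//; lra.
exists y'; split=> // j; rewrite cy' mxE.
have [->|ji] := eqVneq j i; first by rewrite /= mulr0 addr0 ciy eqxx.
by apply/negbTE; rewrite gt_eqF// mulr1 ltr_wpDl ?divr_gt0// om//; exact: Uc.
Qed.

(* All the faces in this union coincide, see [wallE]; it is empty if no point of
   [U] lies in the interior of the i-th wall. *)
Definition wall (i : 'I_d) : set Y :=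
  \bigcup_(y in [set y | U y /\ on_wall i y]) face_at cod y.

Lemma wallE i y : U y -> on_wall i y -> wall i = face_at cod y.
Proof.
move=> Uy wy; apply/seteqP; split=> [z [y' [Uy' wy']]|z]; last by exists y.
rewrite /face_at !(wall_cod _ wy) ?(wall_cod _ wy')//.
by rewrite (same_connected_component (wall_component Uy Uy' wy wy')).
Qed.

Lemma wall_facet i y : U y -> c y ord0 i = 0 -> facet cod (wall i) /\ wall i y.
Proof.
move=> Uy ciy.
have [y1 [_ Uy1 wy1]] := wall_near Uy ciy filterT.
rewrite (wallE Uy1 wy1); split; first by exists y1 => //; exact: (wall_cod Uy1 wy1).
move=> N /(wall_near Uy ciy)[y2 [Ny2 Uy2 wy2]]; exists y2; split=> //.
by rewrite (wall_cod Uy1 wy1); exact: (wall_component Uy1 Uy2 wy1 wy2).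
Qed.

(** Points of codimension 1 in the component that defines [H] come arbitrarily close to [y]. Close
    enough, coordinates positive at [y] stay positive, so the wall such a point lies on also passes
    through [y]. *)
Lemma facet_wall H y : facet cod H -> H y -> U y ->
  exists2 i, c y ord0 i = 0 & H = wall i.
Proof.
move=> [w cw ->] Hy Uy; have [oD om ci cD cl] := cc.
have Dy := Uc Uy.
have N1 : nbhs y (U `&` [set z | forall j, 0 < c y ord0 j -> 0 < c z ord0 j]).
  apply: filterI; first exact: open_nbhs_nbhs.
  apply: filter_forall => j.
  have [yj|_] := ltP 0 (c y ord0 j); last by near=> z => //.
  have cj : c z ord0 j @[z --> y] --> c y ord0 j.
    apply: (@cvg_comp _ _ _ c (fun x : 'rV[R]_d => x ord0 j) _ (nbhs (c y))).
      exact: cD.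
    exact: coord_continuous.
  by move: cj => /cvgr_gt/(_ _ yj); apply: filterS => z.
have [z [Kz [Uz zp]]] := Hy _ N1.
have cz : cod z = 1%N by have := connected_component_sub Kz; rewrite /= cw.
have [i wz _] := cod1_wall Uz cz; exists i.
  apply/eqP; rewrite eq_le om// andbT leNgt; apply/negP => /zp.
  by rewrite lt_def wz eqxx.
rewrite (wallE Uz wz) /face_at cz; rewrite cw in Kz *.
by rewrite (same_connected_component Kz).
Unshelve. all: by end_near. Qed.

End Corners.

(** * Corners: walls, facets and isotropy vectors *)

Lemma near_coord_gt0 {R : realType} {d : nat} (p : 'rV[R]_d) :
  nbhs p [set z : 'rV[R]_d | forall i, 0 < p ord0 i -> 0 < z ord0 i].
Proof.
pose P i (z : 'rV[R]_d) := 0 < p ord0 i -> 0 < z ord0 i.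
have H i : nbhs p (P i).
  rewrite /P; have [pi|_] := ltP 0 (p ord0 i); last by near=> z => //.
  have /cvgr_gt/(_ _ pi) := @coord_continuous R _ _ ord0 i p.
  by apply: filterS.
exact: (@filter_forall _ _ P (nbhs p) _ H).
Unshelve. all: by end_near. Qed.

(** Pigeonhole: with one index removed, too few values remain to cover [S]. For the walls through a
    point and the facets of its face, this says that each wall has its own facet and that the
    collection contains all of them. *)
Lemma card_facets {T : Type} (d : nat) (Z : {set 'I_d}) (H : 'I_d -> T) (S : set T) :
  S `<=` H @` [set` Z] -> (S #= `I_#|Z|)%card ->
  (forall i, i \in Z -> S (H i)) /\ {in Z &, injective H}.
Proof.
move=> SH cS.
have key j : j \in Z -> ~ S `<=` H @` [set` Z :\ j].
  move=> jZ SHj.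
  have : (`I_#|Z| #<= `I_#|Z :\ j|)%card.
    rewrite -(card_le_eql cS); apply: card_le_trans (subset_card_le SHj) _.
    apply: card_le_trans (card_image_le _ _) _.
    have -> : [set` Z :\ j] = (fun k => nth j (enum (Z :\ j)) k) @` `I_#|Z :\ j|.
      apply/seteqP; split=> [i /= iZ|_ [k kZ <-]] /=.
        exists (index i (enum (Z :\ j))); last by rewrite nth_index// mem_enum.
        by rewrite cardE index_mem mem_enum.
      by rewrite -mem_enum mem_nth// -cardE.
    exact: card_image_le.
  by rewrite card_le_II (cardsD1 j Z) jZ add1n ltnn.
split=> [i iZ|i j iZ jZ Hij].
  apply: contrapT => nSi; apply: (key i iZ) => x Sx.
  have [i' i'Z e] := SH x Sx; exists i' => //; rewrite /= !inE.
  rewrite (_ : (i' \in Z) = true)// andbT; apply: contra_notN nSi => /eqP ii'.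
  by rewrite -ii' e.
apply: contrapT => /eqP ij; apply: (key j jZ) => x Sx.
have [i' i'Z e] := SH x Sx; have [i'j|i'j] := eqVneq i' j.
  by exists i; rewrite /= ?inE ?ij// Hij -i'j.
by exists i' => //; rewrite /= !inE i'j.
Qed.

(** The coordinate functionals of the extended basis, matched with indices through their positions
    in [enum I]. They will decide which reflections a group element performs. *)
Lemma basis_dual {n m : nat} (lam : 'I_m -> Z2 n) (I : {set 'I_m}) (s : seq (Z2 n)) :
  basis_of fullv ([seq lam i | i <- enum I] ++ s) ->
  exists chi : 'I_m -> Z2 n -> 'F_2,
    (forall i u v, chi i (u + v) = chi i u + chi i v) /\
    {in I &, forall i j, chi i (lam j) = (i == j)%:R}.
Proof.
move=> /basis_free; set X := _ ++ s => fX.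
have szX j : j \in I -> (index j (enum I) < size X)%N.
  by move=> jI; rewrite /X size_cat size_map ltn_addr// index_mem mem_enum.
have nthX j : j \in I -> nth 0 X (index j (enum I)) = lam j.
  move=> jI; rewrite nth_cat size_map index_mem mem_enum jI.
  by rewrite (nth_map j) ?nth_index ?index_mem ?mem_enum.
suff /choice[chi H] : forall i, exists chi : Z2 n -> 'F_2,
    (forall u v, chi (u + v) = chi u + chi v) /\
    (i \in I -> {in I, forall j, chi (lam j) = (i == j)%:R}).
  by exists chi; split=> [i|i j iI]; have [H1 H2] := H i; [exact: H1|exact: H2].
move=> i; have [iI|_] := boolP (i \in I); last first.
  by exists (fun=> 0); split=> // u v; rewrite addr0.
exists (coord (in_tuple X) (Ordinal (szX i iI))); split=> [u v|_ j jI].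
  by rewrite raddfD.
have := @coord_free _ _ _ (in_tuple X) (Ordinal (szX j jI)) (Ordinal (szX i iI)) fX.
rewrite /= nthX// => ->; congr (_%:R); congr nat_of_bool.
rewrite -val_eqE /=; apply/eqP/eqP => [e|-> //].
by rewrite -[i](@nth_index _ i _ (enum I)) ?mem_enum// -e nth_index ?mem_enum.
Qed.

(* A chart of [Y] on a small set [cU]: every facet meeting [cU] is the zero set of
   one coordinate. The i-th coordinate with [i] in [cL] cuts out the nonexceptional
   facet [cH i], with isotropy vector [clam i]; the functionals [cchi i] are dual
   to these vectors. The exceptional facet, if there is one, is cut out by the
   coordinate [cq]; otherwise [cq] is any coordinate outside [cL], and it is
   positive on [cU]. *)
Record corner (R : realType) (n k m : nat) (Y : topologicalType)
    (AY : set (chart R Y n.+1)) (Q : 'I_k -> set Y) (F : 'I_m -> set Y)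
    (lam : 'I_m -> Z2 n) := Corner {
  cchart : chart R Y n.+1;
  cU : set Y;
  cL : {set 'I_n.+1};
  cq : 'I_n.+1;
  cH : 'I_n.+1 -> set Y;
  clam : 'I_n.+1 -> Z2 n;
  cchi : 'I_n.+1 -> Z2 n -> 'F_2;
  cA : AY cchart;
  cU_open : open cU;
  cU_dom : cU `<=` chart_dom cchart;
  c_pos : forall y i, cU y -> i \notin cL -> i != cq -> 0 < cchart y ord0 i;
  cqL : cq \notin cL;
  c_wall : forall y i, cU y -> i \in cq |: cL -> cchart y ord0 i = 0 <-> cH i y;
  cHQ : forall y j, cU y -> Q j y -> cH cq = Q j;
  cQH : forall y, cU y -> cH cq y -> exists j, cH cq = Q j;
  cHF : forall i, i \in cL -> exists2 f, cH i = F f & clam i = lam f;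
  cFH : forall f y, cU y -> F f y -> exists2 i, i \in cL & cH i = F f;
  cchiD : forall i s t, cchi i (s + t) = cchi i s + cchi i t;
  cchi_lam : {in cL &, forall i j, cchi i (clam j) = (i == j)%:R} }.

Section FaceSimple.
Context (R : realType) (r : regularity) (n k m : nat)
    (Y : topologicalType) (AY : set (chart R Y n.+1)) (cod : Y -> nat)
    (Q : 'I_k -> set Y) (F : 'I_m -> set Y) (lam : 'I_m -> Z2 n).
Hypothesis FS : face_simple r AY cod Q F.
Hypothesis IF : isotropy_function F lam.

Lemma Y_chart c : AY c -> chart_spec n.+1 c.
Proof. by have [[[_ _ [H _ _] _] _] _ _ _ _] := FS; move=> /H /is_chartP. Qed.

Lemma Y_codE c y : AY c -> chart_dom c y -> cod y = num_zeros (c y).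
Proof. by have [[[_ _ _ H] _] _ _ _ _] := FS; exact: H. Qed.

Lemma face_at_self (y : Y) : face_at cod y y.
Proof. by apply: subset_closure; exact: connected_component_refl. Qed.

Lemma face_collection y : exists S, facet_collection cod (cod y) (face_at cod y) S.
Proof.
have [_ _ _ H _] := FS; have [|S [HS _]] := H (cod y) (face_at cod y).
  by exists y.
by exists S.
Qed.

Lemma collection_facets y S : facet_collection cod (cod y) (face_at cod y) S ->
  forall H, S H -> facet cod H /\ H y.
Proof.
move=> [SF _ [y1 _ e]] H SH; split; first exact: SF.
have := @face_at_self y; rewrite e => /connected_component_sub; exact.
Qed.

Lemma facet_FQ H : facet cod H -> (exists f, H = F f) \/ (exists j, H = Q j).
Proof.
have [_ _ _ _ [_ FQ]] := FS; move=> fH.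
have [[j _ <-]|nQ] := pselect (range Q H); first by right; exists j.
have : (facet cod `\` range Q) H by [].
by rewrite -FQ => -[f _ <-]; left; exists f.
Qed.

Lemma F_facet f : facet cod (F f) /\ ~ range Q (F f).
Proof.
have [_ _ _ _ [_ FQ]] := FS.
by have : (facet cod `\` range Q) (F f) by rewrite -FQ; exists f.
Qed.

Lemma corner_data y0 N : nbhs y0 N -> exists (c : chart R Y n.+1) (eps : R) (U : set Y),
  let p := c y0 in
  [/\ AY c, U y0, U `<=` N, open U & U `<=` chart_dom c] /\
  [/\ 0 < eps, forall y, U y -> ball p eps (c y),
      forall z : 'rV[R]_n.+1, ball p eps z -> orthant R n.+1 n.+1 z ->
        exists2 y, U y & c y = z &
      forall (z : 'rV[R]_n.+1) i, ball p eps z -> 0 < p ord0 i -> 0 < z ord0 i].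
Proof.
move=> Ny0; have [[[_ _ [_ cov _] _] _] _ _ _ _] := FS.
have [c Ac Dc] := cov y0; have [oD om ci cD cl] := Y_chart Ac.
pose W := interior N `&` chart_dom c.
have oW : open W by apply: openI => //; exact: open_interior.
have Wy0 : W y0 by [].
have Wy : nbhs y0 W by exact: open_nbhs_nbhs.
have H1 := cl _ _ Dc Wy.
have H2 := near_coord_gt0 (c y0).
have : nbhs (c y0) ([set z | orthant R n.+1 n.+1 z ->
      exists y : Y, [/\ W y, chart_dom c y & c y = z]] `&`
   [set z : 'rV[R]_n.+1 | forall i, 0 < c y0 ord0 i -> 0 < z ord0 i]).
  exact: filterI.
move=> /nbhs_ballP[eps /= e0 He].
exists c, eps, (W `&` c @^-1` ball (c y0) eps); split; split=> //.
- by split=> //; exact: ballxx.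
- by move=> y [[/interior_subset]].
- rewrite openE => y [Wy' By]; apply: filterI; first exact: open_nbhs_nbhs.
  apply: cD; first exact: Wy'.2.
  by apply: open_nbhs_nbhs; split=> //; exact: ball_open.
- by move=> y [[]].
- by move=> y [].
- move=> z Bz oz; have [/(_ oz)[y [Wy' Dy cy]] _] := He z Bz.
  by exists y => //; split=> //=; rewrite cy.
- by move=> z i Bz; have [_] := He z Bz; exact.
Unshelve. all: by end_near. Qed.

(** The facets through [y] are among its [cod y] walls and the collection of its face has [cod y]
    members, so lying in the collection and passing through [y] are the same. The subgroup thus
    becomes pointwise data. *)
Lemma isotropyE y : isotropy_subgroup cod F lam (cod y) (face_at cod y) =
  <<[set lam i | i : 'I_m & `[< F i y >] ]>>%G.
Proof.
rewrite /isotropy_subgroup; congr <<_>>%G; apply/setP => t.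
suff PE (i : 'I_m) : (exists2 S,
    facet_collection cod (cod y) (face_at cod y) S & S (F i)) <-> F i y.
  by apply/imsetP/imsetP => -[i + ->]; rewrite finset.in_set => /asboolP Pi;
     exists i => //; rewrite finset.in_set; apply/asboolP/PE.
split=> [[S HS SF]|Fy].
  by have [] := collection_facets HS SF.
have [S HS] := face_collection y; exists S => //.
have [c [eps [U [[Ac Uy UN oU Uc] [e0 UB BU Bpos]]]]] := corner_data (filterT : nbhs y setT).
have cc := Y_chart Ac; have [oD om ci cD cl] := cc.
have codE := fun y => @Y_codE c y Ac.
have op : orthant R n.+1 n.+1 (c y) by exact/om/Uc.
have [fF _] := F_facet i.
have [j cj ->] := facet_wall cc codE oU Uc UB BU op e0 Bpos fF Fy Uy.
have [SF cS _] := HS.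
have [||H _] := @card_facets _ _ [set i | c y ord0 i == 0]%SET (wall cod c U) S.
- move=> G /(collection_facets HS)[fG Gy].
  have [j' cj' ->] := facet_wall cc codE oU Uc UB BU op e0 Bpos fG Gy Uy.
  by exists j' => //=; rewrite inE cj'.
- by rewrite -num_zerosE -codE//; exact: Uc.
by apply: H; rewrite inE cj.
Qed.

Lemma corner_exists y0 N : nbhs y0 N ->
  exists2 D : corner AY Q F lam, cU D y0 & cU D `<=` N.
Proof.
move=> Ny0.
have [c [eps [U [[Ac Uy0 UN oU Uc] [e0 UB BU Bpos]]]]] := corner_data Ny0.
have cc := Y_chart Ac; have [oD om ci cD cl] := cc.
have codE := fun y => @Y_codE c y Ac.
set p := c y0 in UB BU Bpos.
have op : orthant R n.+1 n.+1 p by exact/om/Uc.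
pose Z := [set i | p ord0 i == 0]%SET.
pose H := wall cod c U.
have UZ y i : U y -> c y ord0 i = 0 -> i \in Z.
  move=> Uy ciy; rewrite inE eq_le op// andbT leNgt.
  by apply/negP => /(Bpos _ _ (UB _ Uy)); rewrite ciy ltxx.
have Hfac i y : U y -> c y ord0 i = 0 -> facet cod (H i) /\ H i y.
  exact: (wall_facet cc codE oU Uc UB BU e0).
have facH G y : facet cod G -> G y -> U y -> exists2 i, c y ord0 i = 0 & G = H i.
  exact: (facet_wall cc codE oU Uc UB BU op e0 Bpos).
have [S HS] := face_collection y0; have [SF cS _] := HS.
have [HSZ HZinj] : (forall i, i \in Z -> S (H i)) /\ {in Z &, injective H}.
  apply: card_facets.
    move=> G /(collection_facets HS)[fG Gy].
    have [j cj ->] := facH _ _ fG Gy Uy0.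
    by exists j => //=; rewrite inE; apply/eqP.
  by rewrite -num_zerosE /p -codE//; exact: Uc.
have Zp i : i \in Z -> facet cod (H i) /\ H i y0.
  by rewrite inE => /eqP; exact: Hfac.
have Hwall y i : U y -> i \in Z -> c y ord0 i = 0 <-> H i y.
  move=> Uy iZ; split=> [/(Hfac _ _ Uy)[]//|Hy].
  have [j cj Hij] := facH _ _ (Zp _ iZ).1 Hy Uy.
  by rewrite (HZinj i j)//; exact: UZ cj.
have [_ [facQ disjQ] vert _ [Finj _]] := FS.
have Qinj j j' y : Q j y -> Q j' y -> j = j'.
  move=> Qj Qj'; apply/eqP; apply: contrapT => /negP/disjQ/seteqP[+ _].
  by move=> /(_ y); apply.
pose L := [set i in Z | `[< exists f, H i = F f >]]%SET.
have LF i : i \in L -> exists f, H i = F f by rewrite inE => /andP[_ /asboolP].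
have LZ i : i \in L -> i \in Z by rewrite inE => /andP[].
have ZL i : i \in Z -> i \notin L -> exists j, H i = Q j.
  move=> iZ; rewrite inE iZ/= => /asboolP nF.
  by have [] := facet_FQ (Zp i iZ).1.
(* Two walls through [y0] outside [L] would belong to exceptional facets with a common point, hence
   to one facet, hence coincide. If there is no such wall, a coordinate positive at [y0] serves as
   [q]. *)
have [q [qL Zq qQ]] : exists q, [/\ q \notin L, forall i, i \in Z -> i \notin L -> i = q &
    q \in Z -> exists j, H q = Q j].
  have [[q [qZ qL]]|nq] := pselect (exists q, q \in Z /\ q \notin L).
    exists q; split=> //; last by move=> _; exact: ZL.
    move=> i iZ iL; have [[j Hj] [j' Hj']] := (ZL i iZ iL, ZL q qZ qL).
    apply: HZinj => //; rewrite Hj Hj'; congr Q.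
    apply: (Qinj _ _ y0); [rewrite -Hj|rewrite -Hj'].
      by have [] := Zp i iZ.
    by have [] := Zp q qZ.
  have [q qZ] : exists q, q \notin Z.
    (* If all coordinates vanish, [y0] is a vertex and lies on an exceptional facet, whose wall is
       not in [L]. *)
    apply: contrapT => nZ; apply: nq.
    have allZ i : i \in Z by apply: contrapT => iZ; apply: nZ; exists i; apply/negP.
    have codn : cod y0 = n.+1.
      rewrite codE; last exact: Uc.
      rewrite num_zerosE -[RHS]card_ord; apply: eq_card => i.
      by have := allZ i; rewrite inE => ->; rewrite inE.
    have : vertices cod n.+1 setT (face_at cod y0) by split=> //; exists y0.
    rewrite vert => -[j _ [_ sub]].
    have Qy0 : Q j y0 by apply: sub; exact: face_at_self.
    have [i _ Hi] := facH _ _ (facQ j) Qy0 Uy0.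
    exists i; split=> //; apply/negP => /LF[f Hf].
    by have [_] := F_facet f; apply; exists j => //; rewrite Hi.
  exists q; split=> //.
  - by apply: contra qZ => /LZ.
  - by move=> i iZ iL; exfalso; apply: nq; exists i.
  - by move=> qZ'; rewrite qZ' in qZ.
pose I := [set f | `[< F f y0 >]]%SET.
have [|s Hs] := IF (I := I).
  by exists y0 => f /=; rewrite inE => /asboolP.
have [chi [chiD chi_lam]] := basis_dual Hs.
have /choice[fi Hfi] : forall i, exists f : option 'I_m,
    i \in L -> exists2 f', f = Some f' & H i = F f'.
  move=> i; have [/LF[f Hf]|_] := boolP (i \in L); last by exists None.
  by exists (Some f) => _; exists f.
pose la i := if fi i is Some f then lam f else 0.
pose ch i t := if fi i is Some f then chi f t else 0.
(* The coordinate [q] may be positive on all of [U]; the empty set then keeps [c_wall] true for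
   it. *)
pose H' i := if i \in Z then H i else set0.
have fiI i f : i \in L -> H i = F f -> f \in I.
  by move=> /LZ/Zp[_ Hy] e; rewrite inE; apply/asboolP; rewrite -e.
unshelve eexists (@Corner R n k m Y AY Q F lam c U L q H' la ch
  Ac oU Uc _ qL _ _ _ _ _ _ _) => //.
- move=> y i Uy iL iq; apply: (Bpos _ _ (UB _ Uy)).
  rewrite lt_def op// andbT; apply: contra_neqN iq => pi0.
  by apply: Zq => //; rewrite inE.
- move=> y i Uy iqL; rewrite /H'; have [iZ|iZ] := boolP (i \in Z); first exact: Hwall.
  by split=> // /(UZ _ _ Uy); rewrite (negbTE iZ).
- move=> y j Uy Qy; have [i ci0 Hi] := facH _ _ (facQ j) Qy Uy.
  have iZ := UZ _ _ Uy ci0.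
  have iL : i \notin L.
    apply/negP => /LF[f Hf]; have [_] := F_facet f; apply.
    by exists j => //; rewrite Hi.
  by rewrite /H' -(Zq i iZ iL) iZ Hi.
- by move=> y Uy; rewrite /H'; case: ifP => // qZ _; exact: qQ.
- move=> i iL; have [f e Hf] := Hfi _ iL; exists f; last by rewrite /la e.
  by rewrite /H' LZ.
- move=> f y Uy Fy; have [fF nQ] := F_facet f.
  have [i ci0 Hi] := facH _ _ fF Fy Uy; have iZ := UZ _ _ Uy ci0.
  exists i; last by rewrite /H' iZ Hi.
  by rewrite inE iZ; apply/asboolP; exists f.
- by move=> i u v; rewrite /ch; case: (fi i) => [f|]; rewrite ?addr0.
- move=> i j iL jL; have [f e Hf] := Hfi _ iL; have [g e' Hg] := Hfi _ jL.
  rewrite /ch /la e e' chi_lam; [|exact: fiI iL Hf|exact: fiI jL Hg].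
  congr (_%:R); congr nat_of_bool; apply/eqP/eqP => [fg|ij].
    by apply: HZinj; rewrite ?LZ// Hf Hg fg.
  by apply: Finj; rewrite -Hf -Hg ij.
Qed.

End FaceSimple.
(** * Principal bundles *)

Section Bundle.
Context {n : nat} {Y : topologicalType} (eta : principal_bundle n Y).
Local Notation E := (Defs.total eta).

(** The counterpart of [chart_spec] for bundles: the homeomorphism with a product becomes local
    constancy of the sheet label together with local lifting into a given sheet. *)
Definition trivializes (U : set Y) (phi : E -> Z2 n) : Prop :=
  [/\ forall e e', U (eta e) -> eta e = eta e' -> phi e = phi e' -> e = e',
      forall y t, U y -> exists2 e, eta e = y & phi e = t,
      forall e, U (eta e) -> \forall e' \near e, phi e' = phi e,
      forall e N, U (eta e) -> nbhs e N ->
        \forall y \near eta e, exists e', [/\ N e', eta e' = y & phi e' = phi e] &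
      forall t e, U (eta e) -> phi (tact t e) = t + phi e].

Lemma trivializesS (U U' : set Y) phi : U' `<=` U -> trivializes U phi ->
  trivializes U' phi.
Proof.
by move=> U'U [i s l h e]; split=> *;
   [apply: i => //|apply: s|apply: l|apply: h|apply: e]; auto.
Qed.

Lemma trivializes_shift U phi (s : Z2 n) : trivializes U phi ->
  trivializes U (fun e => phi e + s).
Proof.
move=> [i su l h eq]; split.
- by move=> e e' Ue ee' /addIr; exact: i.
- by move=> y t /su - /(_ (t - s))[e <- pe]; exists e; rewrite ?pe ?subrK.
- by move=> e /l; apply: filterS => e' ->.
- move=> e N Ue /(h _ _ Ue); apply: filterS => y [e' [Ne' ee' pe']].
  by exists e'; rewrite pe'.
- by move=> t e /eq ->; rewrite addrA.
Qed.

Lemma trivialization_exists y :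
  exists U phi, [/\ open U, U y & trivializes U phi].
Proof.
have [U [phi [oU Uy [[fm fi fs] fc fo] phiD]]] := local_triviality eta y.
exists U, phi; split=> //.
have oE : open (eta @^-1` U) by move/continuousP : (@Defs.proj_continuous n Y eta); exact.
split=> //.
- move=> e e' Ue ee' pp; apply: fi; rewrite ?inE//=; first by rewrite -ee'.
  by rewrite ee' pp.
- move=> y' t Uy'; have [|e Ue [<- <-]] := fs (y', t); first by split.
  by exists e.
- move=> e Ue; move: fc; rewrite continuous_open_subspace// => /(_ e).
  rewrite inE => /(_ Ue) ce.
  have c2 : phi x @[x --> e] --> phi e.
    apply: (@cvg_comp _ _ _ (fun x => (eta x, phi x)) snd _ (nbhs (eta e, phi e))).
      exact: ce.
    exact: cvg_snd.
  have : nbhs (phi e) [set phi e] by rewrite nbhs_principalE.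
  by move=> /c2.
- move=> e N Ue Ne; have [P oP eP] := fo _ (open_interior N).
  have : (U `*` setT `&` P) (eta e, phi e) by rewrite -eP; exists e.
  move=> [_ Pe]; have : nbhs (eta e, phi e) P by exact: open_nbhs_nbhs.
  move=> [[A B]/= [Ae Be] AB].
  have : nbhs (eta e) (A `&` U) by apply: filterI => //; exact: open_nbhs_nbhs.
  apply: filterS => y' [Ay' Uy'].
  have : (U `*` setT `&` P) (y', phi e).
    by split=> //; apply: AB; split=> //=; exact: nbhs_singleton.
  rewrite -eP => -[e' [Ue' /interior_subset Ne'] [<- <-]].
  by exists e'.
Qed.

Lemma tact_free t (e : E) : tact t e = e -> t = 0.
Proof.
move=> te; have [U [phi [_ Ue [_ _ _ _ eq]]]] := trivialization_exists (eta e).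
by have := eq t e Ue; rewrite te => p; apply: (addIr (phi e)); rewrite add0r -p.
Qed.

(** Over each point there are only finitely many sheets, so the neighborhoods found sheet by sheet
    can be intersected; compactness of the base does the rest. *)
Lemma total_compact : compact [set: Y] -> compact [set: E].
Proof.
move=> cY; apply/compact_near_coveringP => I G P FG HP.
have H1 (y : Y) : \forall y' \near y & i \near G, forall e, eta e = y' -> P i e.
  have [U [phi [oU Uy [inj s l h eq]]]] := trivialization_exists y.
  have Hs (t : Z2 n) : \forall y' \near y & j \near G,
      forall e, eta e = y' -> phi e = t -> P j e.
    have [e ee pe] := s y t Uy.
    have [[A B]/= [Ae Be] AB] := HP e Logic.I.
    have Ue : U (eta e) by rewrite ee.
    have HA := h e A Ue Ae; rewrite ee in HA.
    exists ([set y' | exists e', [/\ A e', eta e' = y' & phi e' = phi e]] `&` U, B).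
      by split=> //=; apply: filterI => //; exact: open_nbhs_nbhs.
    move=> [y' j] /= [[[e' [Ae' ee' pe']] Uy'] Bj] e1 e1y p1.
    have -> : e1 = e'.
      by apply: inj; rewrite ?e1y ?ee'// p1 pe' pe.
    by apply: (AB (e', j)).
  pose PP (t : Z2 n) (x : Y * I) := forall e, eta e = x.1 -> phi e = t -> P x.2 e.
  have HF : Filter (filter_prod (nbhs y) G) by exact: filter_prod_filter.
  have := @filter_forall (Y * I)%type _ PP _ HF Hs.
  by apply: filterS => -[y' j] H e ee; exact: (H (phi e)).
move/compact_near_coveringP : cY => /(_ _ G (fun i y => forall e, eta e = y -> P i e) FG).
move=> /(_ (fun y _ => H1 y)); apply: filterS => i H e _.
exact: (H (eta e)).
Qed.

End Bundle.
(** * The charts of W *)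

Lemma F2_add_neq0 (a b : 'F_2) : (a + b != 0) = (a != 0) (+) (b != 0).
Proof. by case: a b => [[|[|a]] //= ia] [[|[|b]] //= ib]. Qed.

Lemma F2P (a : 'F_2) : a = 0 \/ a = 1.
Proof. by case: a => [[|[|a]] //= ia]; [left|right]; apply/val_inj. Qed.

Lemma Z2_addxx {n : nat} (t : Z2 n) : t + t = 0.
Proof.
by apply/rowP => j; rewrite !mxE; case: (F2P (t ord0 j)) => ->; apply/val_inj.
Qed.

Lemma Z2_oppE {n : nat} (t : Z2 n) : - t = t.
Proof. by apply/eqP; rewrite -subr_eq0 -opprD Z2_addxx oppr0. Qed.

Section Corner.
Context {R : realType} {n k m : nat} {Y : topologicalType}
  {AY : set (chart R Y n.+1)} {Q : 'I_k -> set Y} {F : 'I_m -> set Y}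
  {lam : 'I_m -> Z2 n} (D : corner AY Q F lam).
Hypothesis Finj : injective F.
Hypothesis AYc : forall c, AY c -> chart_spec n.+1 c.

(* [t] is in the span of the [clam D i], that is, [t] is the combination of them
   having the coordinates given by the dual functionals. *)
Definition in_span (t : Z2 n) : Prop :=
  t = \sum_(i in cL D) cchi D i t *: clam D i.

(** The factor by which [t] acts on the i-th reflected coordinate. *)
Definition chi_sign (i : 'I_n.+1) (t : Z2 n) : R := (-1) ^+ (cchi D i t != 0).

Lemma chi_signD i s t : chi_sign i (s + t) = chi_sign i s * chi_sign i t.
Proof. by rewrite /chi_sign cchiD F2_add_neq0 signr_addb. Qed.

Lemma chi_sign_sqr i t : chi_sign i t * chi_sign i t = 1.
Proof. by rewrite /chi_sign -expr2 sqrr_sign. Qed.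

Lemma cchi0 i : cchi D i 0 = 0.
Proof. by apply: (addrI (cchi D i 0)); rewrite -cchiD !addr0. Qed.

Lemma in_span0 : in_span 0.
Proof. by rewrite /in_span big1// => i _; rewrite cchi0 scale0r. Qed.

Lemma in_spanD s t : in_span s -> in_span t -> in_span (s + t).
Proof.
rewrite /in_span => hs ht; rewrite {1}hs {1}ht -big_split; apply: eq_bigr => i _.
by rewrite cchiD scalerDl.
Qed.

Lemma in_span_clam j : j \in cL D -> in_span (clam D j).
Proof.
move=> jL; rewrite /in_span (bigD1 j)//= cchi_lam// eqxx scale1r big1 ?addr0//.
by move=> i /andP[iL ij]; rewrite cchi_lam// (negbTE ij) scale0r.
Qed.

Lemma in_span_sum (a : 'I_n.+1 -> 'F_2) :
  let t := \sum_(i in cL D) a i *: clam D i in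
  in_span t /\ {in cL D, forall i, cchi D i t = a i}.
Proof.
move=> t; have cchiZ i (c : 'F_2) v : cchi D i (c *: v) = c * cchi D i v.
  by case: (F2P c) => ->; rewrite ?scale0r ?scale1r ?mul0r ?mul1r ?cchi0.
have ct : {in cL D, forall i, cchi D i t = a i}.
  move=> i iL; rewrite /t (big_morph (cchi D i) (@cchiD _ _ _ _ _ _ _ _ _ D i) (cchi0 i)).
  rewrite (bigD1 i)//= cchiZ cchi_lam// eqxx mulr1 big1 ?addr0// => j /andP[jL ji].
  by rewrite cchiZ cchi_lam// eq_sym (negbTE ji) mulr0.
by split=> //; rewrite /in_span; apply: eq_bigr => i iL; rewrite ct.
Qed.

(** The nonexceptional facets through [y] contribute exactly the vectors [clam D i] with vanishing
    i-th coordinate, and duality turns the subgroup generated by them into conditions on the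
    functionals. *)
Lemma isotropy_spanP y t : cU D y ->
  t \in <<[set lam i | i : 'I_m & `[< F i y >] ]>>%G <->
  in_span t /\ forall i, i \in cL D -> cchart D y ord0 i != 0 -> cchi D i t = 0.
Proof.
move=> Uy.
pose G : {set Z2 n} := [set t | `[< in_span t /\
  forall i, i \in cL D -> cchart D y ord0 i != 0 -> cchi D i t = 0 >] ]%SET.
have GP s : s \in G <-> in_span s /\
    forall i, i \in cL D -> cchart D y ord0 i != 0 -> cchi D i s = 0.
  by rewrite finset.in_set; split=> [/asboolP|H]; [|apply/asboolP].
split.
  have gG : group_set G.
    apply/group_setP; split.
      by apply/GP; split=> [|i _ _]; [exact: in_span0|exact: cchi0].
    move=> u v /GP[u1 u2] /GP[v1 v2]; apply/GP; split; first exact: in_spanD.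
    by move=> i iL ci; rewrite [cchi _ _ _]cchiD u2// v2// addr0.
  suff : <<[set lam i | i : 'I_m & `[< F i y >] ]>>%g \subset Group gG.
    by move=> /fintype.subsetP sub tG; apply/GP/sub.
  rewrite gen_subG; apply/fintype.subsetP => _ /imsetP[f + ->].
  rewrite finset.in_set => /asboolP Fy; apply/GP.
  have [i iL Hi] := cFH Uy Fy; have [f' Hf' la] := cHF iL.
  have ff' : f = f' by apply: Finj; rewrite -Hi.
  rewrite ff' -la; split; first exact: in_span_clam.
  move=> j jL cj; rewrite cchi_lam//; case: eqVneq => // ji.
  by move: cj; rewrite ji => /eqP[]; apply/c_wall; rewrite ?inE ?iL ?orbT// Hi.
move=> [tE tc]; rewrite tE; set J := <<_>>%G.
apply: (@big_ind _ (fun s => s \in J)) => [||i iL]; [exact: group1|exact: groupM|].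
have [ci|ci] := eqVneq (cchart D y ord0 i) 0; last by rewrite tc// scale0r; exact: group1.
have Hy : cH D i y by apply/c_wall => //; rewrite !inE iL orbT.
have [f Hf ->] := cHF iL.
case: (F2P (cchi D i t)) => ->; rewrite ?scale0r ?scale1r; first exact: group1.
apply: mem_gen; apply/imsetP; exists f => //; rewrite finset.in_set.
by apply/asboolP; rewrite -Hf.
Qed.

End Corner.

Section WCharts.
Context {R : realType} {r : regularity} {n k m : nat} {Y : topologicalType}
  {AY : set (chart R Y n.+1)} {cod : Y -> nat} {Q : 'I_k -> set Y}
  {F : 'I_m -> set Y} {lam : 'I_m -> Z2 n} {eta : principal_bundle n Y}.
Hypothesis FS : face_simple r AY cod Q F.
Local Notation E := (Defs.total eta).
Local Notation WW := (W cod F lam eta).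
Local Notation pi := (@W_pi n m Y cod F lam eta).

Lemma F_inj : injective F.
Proof. by have [_ _ _ _ []] := FS. Qed.

Record wdata := WData {
  wc :> corner AY Q F lam;
  wphi : E -> Z2 n;
  w_triv : trivializes (cU wc) wphi }.

Lemma W_piE (D : corner AY Q F lam) e e' : cU D (eta e) ->
  pi e = pi e' <-> eta e = eta e' /\ exists t, [/\ e = tact t e', in_span D t &
    forall i, i \in cL D -> cchart D (eta e) ord0 i != 0 -> cchi D i t = 0].
Proof.
move=> Ue; rewrite W_piP /simb; split=> [/asboolP[ee [t tM ->]]|[ee [t [te t1 t2]]]].
  split; first by rewrite proj_tact.
  exists t.
  move: tM; rewrite -ee (isotropyE lam FS) => /(isotropy_spanP F_inj t Ue)[t1 t2].
  by rewrite proj_tact; split=> // i; rewrite -ee; exact: t2.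
apply/asboolP; split=> //; exists t => //.
by rewrite -ee (isotropyE lam FS); apply/(isotropy_spanP F_inj t Ue).
Qed.

Section OneWChart.
Variable D : wdata.
Local Notation c := (cchart D).
Local Notation phi := (wphi D).

Lemma wchart_spec_corner : chart_spec n.+1 c.
Proof. exact: (Y_chart FS (cA D)). Qed.

Lemma corner_ge0 y i : cU D y -> 0 <= c y ord0 i.
Proof.
by move=> Uy; have [_ om _ _ _] := wchart_spec_corner; apply: om => //; exact: cU_dom.
Qed.

(* Square roots instead of the coordinates themselves: reflecting the coordinates
   would only give continuous transition maps. The transposition puts the
   exceptional coordinate in position 0, as the half-space model requires. *)
Definition wcoord (e : E) : 'rV[R]_n.+1 :=
  \row_j let i := tperm ord0 (cq D) j in
    if i \in cL D then chi_sign D i (phi e) * Num.sqrt (c (eta e) ord0 i)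
    else c (eta e) ord0 i.

(* A left inverse of the passage from the coordinates of [Y] to those of [W]. *)
Definition wfold (u : 'rV[R]_n.+1) : 'rV[R]_n.+1 :=
  \row_i let x := u ord0 (tperm ord0 (cq D) i) in if i \in cL D then x ^+ 2 else x.

(** Reflections only join sheets whose labels differ by an element of the span. Each coset of the
    span gives a separate local piece of [W]; the chart uses the coset of 0. *)
Definition wdom_total (e : E) : Prop := cU D (eta e) /\ in_span D (phi e).

Definition wchart : chart R WW n.+1 :=
  Chart [set w | exists2 e, wdom_total e & pi e = w] (fun w => wcoord (repr w)).

Lemma wcoordE e i : wcoord e ord0 (tperm ord0 (cq D) i) =
  if i \in cL D then chi_sign D i (phi e) * Num.sqrt (c (eta e) ord0 i)
  else c (eta e) ord0 i.
Proof. by rewrite mxE tpermK. Qed.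

Lemma wfold_wcoord e : cU D (eta e) -> wfold (wcoord e) = c (eta e).
Proof.
move=> Ue; apply/rowP => i; rewrite mxE wcoordE; case: ifP => // iL.
by rewrite /= exprMn sqr_sqrtr ?corner_ge0// /chi_sign sqrr_sign mul1r.
Qed.

Lemma W_pi_phi e e' : cU D (eta e) ->
  pi e = pi e' <-> [/\ eta e = eta e', in_span D (phi e - phi e') &
    forall i, i \in cL D -> c (eta e) ord0 i != 0 -> cchi D i (phi e - phi e') = 0].
Proof.
move=> Ue; have [inj _ _ _ eq] := w_triv D.
split=> [/(W_piE _ Ue)[ee [t [te t1 t2]]]|[ee t1 t2]].
  have -> : phi e - phi e' = t by rewrite te eq ?addrK// -ee.
  by split.
apply/(W_piE _ Ue); split=> //; exists (phi e - phi e'); split=> //.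
apply: inj; rewrite ?proj_tact// eq ?subrK//.
by rewrite -ee.
Qed.

(** Identified points can differ in the i-th sign only where the i-th coordinate vanishes, and there
    the square root hides the sign. *)
Lemma wcoord_pi e e' : cU D (eta e) -> pi e = pi e' ->
  wcoord e = wcoord e' /\ (in_span D (phi e) <-> in_span D (phi e')).
Proof.
move=> Ue /(W_pi_phi _ Ue)[ee t1 t2]; split.
  apply/rowP => j; rewrite -[j](tpermK ord0 (cq D)) !wcoordE.
  set i := tperm _ _ j; case: ifP => // iL; rewrite -ee //.
  have [->|ci] := eqVneq (c (eta e) ord0 i) 0; first by rewrite sqrtr0 !mulr0.
  congr (_ * _); rewrite -[phi e](subrK (phi e')) chi_signD.
  by rewrite /chi_sign t2// eqxx expr0 mul1r.
split=> h; last by rewrite -[phi e](subrK (phi e')); exact: in_spanD.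
rewrite (_ : phi e' = (phi e - phi e') + phi e); first exact: in_spanD.
by rewrite addrAC Z2_addxx add0r Z2_oppE.
Qed.

(** Folding recovers the point of [Y]. Where a reflected coordinate is nonzero its sign can be read
    off, and elsewhere the sign is irrelevant in [W]. *)
Lemma wcoord_inj e e' : wdom_total e -> wdom_total e' ->
  wcoord e = wcoord e' -> pi e = pi e'.
Proof.
move=> [Ue se] [Ue' se'] cc.
have [_ _ ci _ _] := wchart_spec_corner.
have ee : eta e = eta e'.
  apply: ci; rewrite ?inE; [exact: cU_dom|exact: cU_dom|].
  by rewrite -!wfold_wcoord// cc.
apply/(W_pi_phi _ Ue); split=> //.
  by rewrite -[_ - _]/(_ + _) Z2_oppE; exact: in_spanD.
move=> i iL cne0; have /rowP/(_ (tperm ord0 (cq D) i)) := cc.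
rewrite !wcoordE iL -ee => /mulIf; rewrite sqrtr_eq0 -ltNge.
rewrite lt_def cne0 corner_ge0// => /(_ isT) sg.
apply/eqP; apply: contraT => h; have := chi_signD D i (phi e - phi e') (phi e').
rewrite subrK {2}/chi_sign h expr1 -sg mulN1r => /eqP.
rewrite -addr_eq0 -mulr2n mulrn_eq0/= => /eqP s0.
by have := chi_sign_sqr D i (phi e); rewrite s0 mulr0 => /esym/eqP; rewrite oner_eq0.
Qed.

Lemma wchart_pi e : chart_dom wchart (pi e) <-> wdom_total e.
Proof.
split=> [[e' [Ue' se'] pe]|]; last by exists e.
have [ee _ _] := (W_pi_phi _ Ue').1 pe.
by split; [rewrite -ee|apply/(wcoord_pi Ue' pe).2].
Qed.

Lemma wchartE e : wdom_total e -> wchart (pi e) = wcoord e.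
Proof.
move=> [Ue se] /=; apply/esym; apply: (wcoord_pi Ue _).1.
by rewrite /W_pi reprK.
Qed.

End OneWChart.
End WCharts.

(** * The coordinates of W as half-space charts *)

Section WChartSpec.
Context {R : realType} {r : regularity} {n k m : nat} {Y : topologicalType}
  {AY : set (chart R Y n.+1)} {cod : Y -> nat} {Q : 'I_k -> set Y}
  {F : 'I_m -> set Y} {lam : 'I_m -> Z2 n} {eta : principal_bundle n Y}.
Hypothesis FS : face_simple r AY cod Q F.
Local Notation E := (Defs.total eta).
Local Notation WW := (W cod F lam eta).
Local Notation pi := (@W_pi n m Y cod F lam eta).

Lemma W_open (O : set WW) : open O <-> open (pi @^-1` O).
Proof. by []. Qed.

Lemma W_pi_continuous : continuous (pi : E -> WW).
Proof. by apply/continuousP => O /W_open. Qed.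

Lemma W_pi_surj (w : WW) : exists e, pi e = w.
Proof. by exists (repr w); rewrite /W_pi reprK. Qed.

Variable D : @wdata R n k m Y AY Q F lam eta.
Local Notation c := (cchart D).
Local Notation phi := (wphi D).

Lemma wfold_continuous : continuous (wfold D).
Proof.
move=> u; apply: continuous_rV => i; rewrite /wfold mxE.
rewrite [X in X @ _ --> _](_ : _ = fun x : 'rV[R]_n.+1 =>
  if i \in cL D then x ord0 (tperm ord0 (cq D) i) ^+ 2
  else x ord0 (tperm ord0 (cq D) i)); last by apply/funext => x; rewrite mxE.
case: ifP => _; last exact: coord_continuous.
apply: (@cvg_comp _ _ _ (fun x : 'rV[R]_n.+1 => x ord0 (tperm ord0 (cq D) i))
  (fun x : R => x ^+ 2) _ (nbhs (u ord0 (tperm ord0 (cq D) i)))).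
  exact: coord_continuous.
exact: exprn_continuous.
Qed.

Lemma wdom_total_open : open (wdom_total D).
Proof.
have [_ _ lc _ _] := w_triv D.
rewrite openE => e [Ue se].
have H1 : nbhs e (eta @^-1` cU D).
  by apply: (@Defs.proj_continuous n Y eta); apply: open_nbhs_nbhs; split=> //; exact: cU_open.
apply: filterS2 H1 (lc e Ue) => e' Ue' pe'; split=> //.
by rewrite pe'.
Qed.

Lemma wcoord_continuous e : wdom_total D e -> {for e, continuous (wcoord D)}.
Proof.
move=> [Ue se]; have [_ _ lc _ _] := w_triv D.
have [_ _ _ cc _] := wchart_spec_corner FS D.
have ce i : c (eta x) ord0 i @[x --> e] --> c (eta e) ord0 i.
  apply: (@cvg_comp _ _ _ (fun x => c (eta x)) (fun x : 'rV[R]_n.+1 => x ord0 i)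
    _ (nbhs (c (eta e)))); last exact: coord_continuous.
  apply: (@cvg_comp _ _ _ eta c _ (nbhs (eta e))).
    exact: (@Defs.proj_continuous n Y eta).
  by apply: cc; exact: cU_dom.
apply: continuous_rV => j.
pose i := tperm ord0 (cq D) j.
pose g x := if i \in cL D then chi_sign D i (phi e) * Num.sqrt (c (eta x) ord0 i)
    else c (eta x) ord0 i.
have gE : wcoord D e ord0 j = g e by rewrite mxE.
rewrite gE; apply: cvg_trans (_ : g @ e --> g e).
  apply: near_eq_cvg; apply: filterS (lc e Ue) => x px.
  by rewrite /g mxE px.
rewrite /g; case: ifP => _; last exact: ce.
apply: cvgM; first exact: cvg_cst.
apply: (@cvg_comp _ _ _ (fun x => c (eta x) ord0 i) Num.sqrt _
  (nbhs (c (eta e) ord0 i))); first exact: ce.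
exact: sqrt_continuous.
Qed.

Lemma wchart_open : open (chart_dom (wchart (cod := cod) D)).
Proof.
apply/W_open; rewrite (_ : _ @^-1` _ = wdom_total D); first exact: wdom_total_open.
by apply/seteqP; split=> e /(wchart_pi FS).
Qed.

Lemma wcoord0 e : wcoord D e ord0 ord0 = c (eta e) ord0 (cq D).
Proof. by have := wcoordE D e (cq D); rewrite tpermR (negbTE (cqL D)). Qed.

Lemma wchart_orthant e : wdom_total D e -> orthant R n.+1 1 (wcoord D e).
Proof.
move=> [Ue _] i i1; have -> : i = ord0 by apply/val_inj; case: i i1 => [[]].
by rewrite wcoord0 (corner_ge0 FS).
Qed.

(** The openness clause of the chart. A vector [u] is realized over the point with coordinates
    [wfold D u], in the sheet given by its signs. This sheet need not contain [e0], so nearness to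
    [pi e0] has to be shown in the quotient. *)
Lemma wchart_lift e0 (N : set WW) : wdom_total D e0 -> nbhs (pi e0) N ->
  \forall u \near wcoord D e0, orthant R n.+1 1 u ->
    exists e, [/\ N (pi e), wdom_total D e & wcoord D e = u].
Proof.
move=> De0 Ne0; have [Ue0 se0] := De0.
have [inj su lc lift _] := w_triv D.
have cs := wchart_spec_corner FS D; have [_ om ci cc cl] := cs.
set u0 := wcoord D e0; pose y0 := eta e0.
pose tau := tperm ord0 (cq D).
pose compat t (u : 'rV[R]_n.+1) :=
  forall i, i \in cL D -> 0 <= chi_sign D i t * u ord0 (tau i).
have fu0 : wfold D u0 = c y0 by exact: (wfold_wcoord FS).
(* If the signs of the label [t] agree with those of [u0], the point of sheet [t] over [y0] is
   identified with [e0], and lifting near it lands in [N]. There are finitely many labels, so one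
   neighborhood serves all of them. *)
have A (t : Z2 n) : nbhs u0 [set u | in_span D t -> compat t u0 ->
    orthant R n.+1 n.+1 (wfold D u) ->
    exists e, [/\ N (pi e), cU D (eta e), c (eta e) = wfold D u & phi e = t]].
  have [st|nst] := pselect (in_span D t); last by apply: filterE => u /nst.
  have [ct|nct] := pselect (compat t u0); last by apply: filterE => u _ /nct.
  have [et eet pet] := su y0 t Ue0.
  have Uet : cU D (eta et) by rewrite eet.
  have Net : nbhs et (pi @^-1` N).
    apply: W_pi_continuous; rewrite (_ : pi et = pi e0)//.
    have Det : wdom_total D et by split; rewrite ?pet.
    apply: (wcoord_inj FS Det De0).
    apply/rowP => j; rewrite -[j](tpermK ord0 (cq D)) -/tau !wcoordE eet pet.
    case: ifP => // iL; set i := tau j in iL *.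
    have := ct _ iL; rewrite /u0 wcoordE iL -/y0.
    have [->|s0] := eqVneq (Num.sqrt (c y0 ord0 i)) 0; first by rewrite !mulr0.
    have sp : 0 < Num.sqrt (c y0 ord0 i) by rewrite lt_def s0 sqrtr_ge0.
    rewrite mulrA pmulr_lge0// /chi_sign => sg; congr (_ * _); move: sg.
    case: (cchi D i t != 0); case: (cchi D i (phi e0) != 0);
      rewrite /= ?expr1 ?expr0 ?mulr1 ?mul1r ?mulrN1 ?opprK //;
      by rewrite oppr_ge0 ler10.
  have H1 := lift et _ Uet Net; rewrite eet in H1.
  have H2 : nbhs y0 (cU D) by apply: open_nbhs_nbhs; split=> //; exact: cU_open.
  have H12 := nbhsI H1 H2.
  have := cl _ _ (cU_dom Ue0) H12; rewrite -[c _]fu0 => H3.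
  have := wfold_continuous H3.
  apply: (@filterS _ _ (nbhs_filter u0)) => u H _ _ ou; have [y [[[e [Ne ey pe]] Uy] _ cy]] := H ou.
  by exists e; rewrite ey pe.
(* Nonzero coordinates of [u0] keep their sign nearby, so a label that fits [u] also fits [u0]. *)
have B : nbhs u0 [set u | forall i, i \in cL D -> forall t,
    0 <= chi_sign D i t * u ord0 (tau i) -> 0 <= chi_sign D i t * u0 ord0 (tau i)].
  pose P i (u : 'rV[R]_n.+1) := i \in cL D -> forall t,
    0 <= chi_sign D i t * u ord0 (tau i) -> 0 <= chi_sign D i t * u0 ord0 (tau i).
  suff H i : nbhs u0 (P i) by exact: (@filter_forall _ _ P _ (nbhs_filter u0) H).
  pose P2 t (u : 'rV[R]_n.+1) :=
    0 <= chi_sign D i t * u ord0 (tau i) -> 0 <= chi_sign D i t * u0 ord0 (tau i).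
  suff H t : nbhs u0 (P2 t).
    have := @filter_forall _ _ P2 _ (nbhs_filter u0) H.
    by apply: (@filterS _ _ (nbhs_filter u0)) => u Hu _ t; exact: Hu.
  rewrite /P2; have [_|neg] := leP 0 (chi_sign D i t * u0 ord0 (tau i)).
    by apply: filterE.
  have cvg : chi_sign D i t * u ord0 (tau i) @[u --> u0] -->
      chi_sign D i t * u0 ord0 (tau i).
    by apply: cvgM; [exact: cvg_cst|exact: coord_continuous].
  move/cvgr_lt : cvg => /(_ _ neg).
  by apply: (@filterS _ _ (nbhs_filter u0)) => u; rewrite ltNge => /negbTE ->.
(* Reflected coordinates become squares, the coordinate [cq D] is nonnegative by the half-space
   condition, and the others are positive at [y0], hence nearby. *)
have C : nbhs u0 [set u | orthant R n.+1 1 u -> orthant R n.+1 n.+1 (wfold D u)].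
  have := near_coord_gt0 (c y0); rewrite -[c y0]fu0 => /wfold_continuous.
  apply: (@filterS _ _ (nbhs_filter u0)) => u Hu ou i _.
  have [iL|iL] := boolP (i \in cL D); first by rewrite mxE iL sqr_ge0.
  have [iq|iq] := eqVneq i (cq D).
    by rewrite mxE (negbTE iL) iq tpermR; exact: ou.
  by apply/ltW/Hu; rewrite fu0; exact: c_pos.
have {}A := @filter_forall _ _ _ _ (nbhs_filter u0) A.
have := nbhsI A (nbhsI B C).
apply: (@filterS _ _ (nbhs_filter u0)) => u [{}A [{}B {}C]] ou.
(* A zero coordinate counts as positive; its sign does not affect the point. *)
pose a i : 'F_2 := (u ord0 (tau i) < 0)%R%:R.
have [st ct] := in_span_sum D a; set t := \sum_(i in _) _ in st ct.
have sgt i : i \in cL D -> chi_sign D i t = (-1) ^+ (u ord0 (tau i) < 0)%R.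
  by move=> iL; rewrite /chi_sign ct// /a; case: (_ < _)%R.
have cu i : i \in cL D -> chi_sign D i t * `|u ord0 (tau i)| = u ord0 (tau i).
  by move=> iL; rewrite sgt// mulr_sign_norm.
have compatu : compat t u0.
  move=> i iL; apply: B => //; rewrite -(cu _ iL) mulrA chi_sign_sqr mul1r.
  exact: normr_ge0.
have [e [Ne Ue ce pe]] := A t st compatu (C ou).
exists e; split=> //; first by split=> //; rewrite pe.
apply/rowP => j; rewrite -[j](tpermK ord0 (cq D)) wcoordE ce pe.
case: ifP => iL; rewrite mxE iL tpermK -[j](tpermK ord0 (cq D)) -/tau.
  by rewrite sqrtr_sqr tpermK -/tau cu.
by rewrite tpermK.
Qed.

Lemma wchart_is_chart : is_chart 1 (wchart (cod := cod) D).
Proof.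
apply/is_chartP; split; first exact: wchart_open.
- move=> w [e De <-]; rewrite (wchartE FS)//; exact: wchart_orthant.
- move=> w w'; rewrite !inE => -[e De <-] [e' De' <-]; rewrite !(wchartE FS)//.
  exact: (wcoord_inj FS De De').
- move=> _ [e De <-] N; rewrite (wchartE FS)// => Ne.
  pose O := [set w | chart_dom (wchart (cod := cod) D) w /\
    (interior N) (wchart (cod := cod) D w)].
  have oO : open O.
    apply/W_open; rewrite openE => e' [/(wchart_pi FS) De' Ne'].
    rewrite (wchartE FS)// in Ne'.
    have H1 : nbhs e' (wdom_total D).
      by apply: open_nbhs_nbhs; split=> //; exact: wdom_total_open.
    have H2 : nbhs e' (wcoord D @^-1` (interior N)).
      apply: (wcoord_continuous De'); apply: open_nbhs_nbhs; split=> //.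
      exact: open_interior.
    apply: filterS2 H1 H2 => x Dx Nx; split; first exact/(wchart_pi FS).
    by rewrite (wchartE FS).
  have : nbhs (pi e) O.
    apply: open_nbhs_nbhs; split=> //; split; first exact/(wchart_pi FS).
    by rewrite (wchartE FS).
  by apply: filterS => w [_ /interior_subset].
- move=> _ N [e De <-] Ne; rewrite (wchartE FS)//.
  have := wchart_lift De Ne; apply: filterS => u H /H[e' [Ne' De' <-]].
  exists (pi e'); split=> //; first exact/(wchart_pi FS).
  by rewrite (wchartE FS).
Qed.

End WChartSpec.
(** * Transition maps *)

Lemma smooth_onP {R : realType} (d e : nat) (V : set 'rV[R]_d)
    (g : 'rV[R]_d -> 'rV[R]_e) :
  smooth_on V g <-> forall j, smooth V (fun y => g y ord0 j).
Proof. by split=> H j; apply/smoothP; exact: H. Qed.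

Lemma smooth_in {R : realType} (d : nat) (V V' : set 'rV[R]_d) (f : 'rV[R]_d -> R) :
  V' `<=` V -> smooth V f -> smooth V' f.
Proof. by move=> V'V Sf N; exact: CkW (Sf N). Qed.

Section YTransition.
Context {R : realType} {d : nat} {Y : topologicalType} (a a' : chart R Y d).
Hypothesis ac : chart_spec d a.
Hypothesis ac' : chart_spec d a'.
Hypothesis reg : regular_in_charts Smooth a a' (@idfun Y).
Context (y0 : Y).
Hypothesis Dy0 : chart_dom a y0.
Hypothesis Dy0' : chart_dom a' y0.

(* The i'-th component of the transition map vanishes on the wall [x_i = 0], so
   Hadamard's lemma divides it by [x_i]. *)
Lemma wall_quotient i i' :
  a y0 ord0 i = 0 ->
  (\forall y \near y0, a y ord0 i = 0 -> a' y ord0 i' = 0) ->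
  exists (B : set 'rV[R]_d) h, [/\ open B, B (a y0), smooth B h &
    \forall y \near y0, a' y ord0 i' = a y ord0 i * h (a y)].
Proof.
move=> p0 Hy; have [V [g [oV Vp Sg ge]]] := reg Dy0 Dy0'.
have [oD om ci cc cl] := ac; have [oD' _ _ _ _] := ac'.
have nD : nbhs y0 (chart_dom a) by exact: open_nbhs_nbhs.
have nD' : nbhs y0 (chart_dom a') by exact: open_nbhs_nbhs.
have HD' := nbhsI Hy nD'.
have nV : nbhs (a y0) V by exact: open_nbhs_nbhs.
have := nbhsI nV (cl _ _ Dy0 HD').
move=> /nbhs_ballP[e /= e0 He].
pose B := (ball (a y0) e : set 'rV[R]_d).
(* The ball is stable under shrinking because the i-th coordinate of its center is 0. *)
have Bshrink (s : R) x : 0 <= s <= 1 -> B x -> B (shrink i s x).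
  move=> /andP[s0 s1] /ball_rVP[_ Bx]; apply/ball_rVP; split=> // j.
  rewrite !mxE eqxx /=; have [->|ji] := eqVneq j i; last by rewrite mulr0 add0r.
  rewrite mulr1 p0 sub0r normrN mulrBl mul1r subrK normrM ger0_norm//.
  have := Bx i; rewrite p0 sub0r normrN; apply: le_lt_trans.
  by rewrite ler_piMl.
have oB : open B by exact: ball_open.
have Sf : smooth B (fun x => g x ord0 i').
  apply: smooth_in ((smooth_onP _ _).1 Sg i') => x Bx.
  by have [] := He _ Bx.
have [h Sh hE] := hadamard oB Bshrink Sf.
exists B, h; split=> //; first exact: ballxx.
have nB : nbhs y0 (a @^-1` B).
  by apply: cc => //; apply: open_nbhs_nbhs; split=> //; exact: ballxx.
near=> y.
have Dy : chart_dom a y by near: y.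
have Dy' : chart_dom a' y by near: y.
have By : B (a y) by near: y.
have [Vy _] := He _ By.
rewrite -[a' y](ge y)// hE//.
(* The extension [g] agrees with [a'] only on the orthant. Setting the i-th coordinate to 0 stays
   there, so the shrunk point comes from a point [y1] of the wall, where the hypothesis gives the
   value 0. *)
have By0 : B (shrink i 0 (a y)) by apply: Bshrink => //; rewrite lexx ler01.
have sh0 j : shrink i 0 (a y) ord0 j = if j == i then 0 else a y ord0 j.
  by rewrite !mxE eqxx /=; case: eqVneq => [->|_];
    rewrite ?mulr0 ?add0r// mulr1 mulN1r addNr.
have [V0 +] := He _ By0.
case.
  by move=> j _; rewrite sh0; case: ifP => // _; exact: om.
move=> y1 [[Hy1 Dy1'] Dy1 e1].
rewrite -e1 ge//; last by rewrite e1.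
by rewrite Hy1 ?add0r// e1 sh0 eqxx.
Unshelve. all: by end_near. Qed.

Lemma near_wall_pos i (P : set Y) : nbhs y0 P -> exists y, P y /\ 0 < a y ord0 i.
Proof.
move=> Py0; have [oD om ci cc cl] := ac.
have := cl _ _ Dy0 Py0 => /nbhs_ballP[e /= e0 He].
pose z : 'rV[R]_d := a y0 + (e / 2) *: delta_mx ord0 i.
have e20 : 0 < e / 2 by rewrite divr_gt0.
have zj j : z ord0 j = a y0 ord0 j + e / 2 * (j == i)%:R by rewrite !mxE eqxx.
have [||y [Py Dy cy]] := He z.
- apply/ball_rVP; split=> // j.
  rewrite zj opprD addNKr normrN normrM (ger0_norm (ltW e20)).
  case: (j == i); rewrite ?normr1 ?normr0 ?mulr1 ?mulr0//.
  by rewrite ltr_pdivrMr// ltr_pMr// ltr1n.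
- move=> j _; rewrite zj addr_ge0 ?om//.
  by rewrite mulr_ge0 ?(ltW e20)// ler0n.
exists y; split=> //; rewrite cy zj eqxx mulr1 ltr_wpDl//.
exact: om.
Qed.

(* The two quotients are inverse to each other off the wall. *)
Lemma wall_quotient_pos i i' (B B' : set 'rV[R]_d) h h' :
  open B -> B (a y0) -> smooth B h -> open B' -> B' (a' y0) -> smooth B' h' ->
  (\forall y \near y0, a' y ord0 i' = a y ord0 i * h (a y)) ->
  (\forall y \near y0, a y ord0 i = a' y ord0 i' * h' (a' y)) ->
  0 < h (a y0).
Proof.
move=> oB Bp Sh oB' Bp' Sh' H H'.
have [oD om _ cc _] := ac; have [oD' om' _ cc' _] := ac'.
have ch : h (a y) @[y --> y0] --> h (a y0).
  apply: (@cvg_comp _ _ _ a h _ (nbhs (a y0))); first exact: cc.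
  exact: (Sh 0%N).1.
have ch' : h' (a' y) @[y --> y0] --> h' (a' y0).
  apply: (@cvg_comp _ _ _ a' h' _ (nbhs (a' y0))); first exact: cc'.
  exact: (Sh' 0%N).1.
have nD' : nbhs y0 (chart_dom a') by exact: open_nbhs_nbhs.
(* A negative value would make a coordinate of [a'] negative at nearby points off the wall. A zero
   value would make the product of the two quotients small at points where it equals 1. *)
rewrite ltNge; apply/negP; rewrite le_eqVlt => /predU1P[h0|hneg]; last first.
  have /cvgr_lt/(_ _ hneg) hn := ch.
  have N1 := nbhsI (nbhsI H nD') hn.
  have [y [[[E1 Dy'] hny] apos]] := near_wall_pos i N1.
  have := om' y Dy' i' (ltn_ord i').
  by rewrite E1 pmulr_rge0// leNgt hny.
have hh : h (a y) * h' (a' y) @[y --> y0] --> h (a y0) * h' (a' y0) by exact: cvgM.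
rewrite h0 mul0r in hh; have /cvgr_lt/(_ _ ltr01) hl := hh.
have N1 := nbhsI (nbhsI H H') hl.
have [y [[[E1 E2] hly] apos]] := near_wall_pos i N1.
move: E2; rewrite E1 -mulrA => E2.
suff e : h (a y) * h' (a' y) = 1 by move: hly; rewrite /= e ltxx.
by apply: (mulfI (lt0r_neq0 apos)); rewrite -E2 mulr1.
Qed.

End YTransition.

(** * Comparison of two corners along common facets *)

Section WTransition.
Context {R : realType} {r : regularity} {n k m : nat} {Y : topologicalType}
  {AY : set (chart R Y n.+1)} {cod : Y -> nat} {Q : 'I_k -> set Y}
  {F : 'I_m -> set Y} {lam : 'I_m -> Z2 n} {eta : principal_bundle n Y}.
Hypothesis FS : face_simple r AY cod Q F.
Local Notation E := (Defs.total eta).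
Local Notation WW := (W cod F lam eta).
Local Notation pi := (@W_pi n m Y cod F lam eta).
Local Notation wdata := (@wdata R n k m Y AY Q F lam eta).

(** Continuity of the map from [W] to [Y] induced by the bundle projection, expressed through
    representatives. *)
Lemma W_nbhs_proj e (P : set Y) : nbhs (eta e) P ->
  nbhs (pi e) [set w : WW | P (eta (repr w))].
Proof.
move=> Pe.
have er (e' : E) : eta (repr (pi e')) = eta e'.
  have : pi (repr (pi e')) = pi e' by rewrite /W_pi reprK.
  by move=> /W_piP/asboolP[].
pose O := [set w : WW | interior P (eta (repr w))].
have oO : open O.
  apply/W_open; rewrite (_ : _ @^-1` _ = eta @^-1` interior P).
    by move/continuousP : (@Defs.proj_continuous n Y eta); apply; exact: open_interior.
  by apply/seteqP; split=> e' /=; rewrite /O /= er.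
have : nbhs (pi e) O by apply: open_nbhs_nbhs; split=> //; rewrite /O /= er.
by apply: filterS => w; exact: interior_subset.
Qed.

Lemma wchart_near (D : wdata) e0 (N : set WW) : wdom_total D e0 -> nbhs (pi e0) N ->
  nbhs (wcoord D e0) [set u | forall e, wdom_total D e -> wcoord D e = u -> N (pi e)].
Proof.
move=> De0 /(wchart_lift FS De0); apply: filterS => u H e De eu.
have [|e' [Ne' De' e'u]] := H; first by rewrite -eu; exact: (wchart_orthant FS).
by rewrite -(wcoord_inj FS De' De)// e'u.
Qed.

Lemma smooth_wfold (D : wdata) (V : set 'rV[R]_n.+1) f : open V -> smooth V f ->
  smooth (wfold D @^-1` V) (fun u => f (wfold D u)).
Proof.
move=> oV Sf N.
have oV' : open (wfold D @^-1` V).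
  by move/continuousP : (@wfold_continuous R n k m Y AY Q F lam eta D); exact.
pose tau := tperm ord0 (cq D).
pose psi j (x : R) := if tau j \in cL D then x ^+ 2 else x.
pose dpsi j (x : R) : R := if tau j \in cL D then 2 * x else 1.
apply: (@Ck_comp R _ _ N V _ (wfold D) tau psi dpsi) => //.
- by move=> u _; exact: wfold_continuous.
- move=> j h u; apply/rowP => i; rewrite !mxE /psi eqxx /=.
  have [->|ij] := eqVneq i (tau j).
    by rewrite tpermK !eqxx !mulr1; case: ifP => _; rewrite subrK.
  have /negbTE tij : tperm ord0 (cq D) i != j.
    by apply: contra ij => /eqP <-; rewrite tpermK.
  by rewrite tij !mulr0 !add0r.
- move=> j x; rewrite /psi /dpsi; case: ifP => _; last exact: is_derive_id.
  have M := @is_deriveM R R id id x 1 1 1 (is_derive_id _ _) (is_derive_id _ _).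
  rewrite [X in is_derive _ _ X](_ : _ = (id * id : R -> R)).
    by apply: is_derive_eq M _; rewrite /= [_%:A]mulr1 mulr_natl mulr2n.
  by apply/funext => z; rewrite expr2.
- move=> j; rewrite /dpsi; case: (tau j \in cL D) => N'; last exact: Ck_cst.
  by apply: CkM => //; [exact: Ck_cst|exact: smooth_coord].
Qed.

Lemma cchi_sum (D : wdata) i (a : 'I_n.+1 -> 'F_2) (v : 'I_n.+1 -> Z2 n) (P : pred 'I_n.+1) :
  cchi D i (\sum_(j | P j) a j *: v j) = \sum_(j | P j) a j * cchi D i (v j).
Proof.
rewrite (big_morph (cchi D i) (@cchiD _ _ _ _ _ _ _ _ _ D i) (cchi0 D i)).
apply: eq_bigr => j _.
by case: (F2P (a j)) => ->; rewrite ?scale0r ?scale1r ?mul0r ?mul1r ?cchi0.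
Qed.

Lemma clam_wall (D D' : wdata) i i' : i \in cL D -> i' \in cL D' ->
  cH D i = cH D' i' -> clam D i = clam D' i'.
Proof.
move=> iL iL' HH; have [f Hf ->] := cHF iL; have [f' Hf' ->] := cHF iL'.
by congr lam; apply: (F_inj FS); rewrite -Hf -Hf'.
Qed.

Lemma cH_inj (D D' : wdata) i i' j j' : i \in cL D -> i' \in cL D' ->
  j \in cL D -> j' \in cL D' ->
  cH D i = cH D' i' -> cH D j = cH D' j' -> (i == j) = (i' == j').
Proof.
move=> iL iL' jL jL' Hi Hj.
have inj (D1 : wdata) a b : a \in cL D1 -> b \in cL D1 -> cH D1 a = cH D1 b -> a = b.
  move=> aL bL Hab; have := cchi_lam aL bL.
  rewrite -(clam_wall aL bL Hab) cchi_lam// eqxx => /eqP.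
  by case: (eqVneq a b).
apply/eqP/eqP => [ij|ij].
  by apply: (inj D') => //; rewrite -Hi -Hj ij.
by apply: (inj D) => //; rewrite Hi Hj ij.
Qed.

(* Hence the sign relating the two square roots is constant along the fibres of
   [pi]. *)
Lemma chi_wall (D D' : wdata) i i' y t : cU D y -> cU D' y ->
  i \in cL D -> i' \in cL D' -> cH D i = cH D' i' ->
  in_span D t -> (forall j, j \in cL D -> cchart D y ord0 j != 0 -> cchi D j t = 0) ->
  cchi D' i' t = cchi D i t.
Proof.
move=> Uy Uy' iL iL' HH st tc; rewrite [in LHS]st cchi_sum.
transitivity (\sum_(j in cL D) cchi D j t * (i == j)%:R); last first.
  rewrite (bigD1 i)//= eqxx mulr1 big1 ?addr0// => j /andP[_ ji].
  by rewrite eq_sym (negbTE ji) mulr0.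
apply: eq_bigr => j jL.
have [cj|cj] := eqVneq (cchart D y ord0 j) 0; last by rewrite tc// !mul0r.
congr (_ * _).
have Hy : cH D j y by apply/c_wall => //; rewrite !inE jL orbT.
have [f Hf la] := cHF jL; rewrite Hf in Hy.
have [j' jL' Hj'] := cFH Uy' Hy.
rewrite (clam_wall jL jL') ?Hf ?Hj'// cchi_lam//.
by rewrite (cH_inj iL iL' jL jL')// Hf Hj'.
Qed.

End WTransition.

(** * Smoothness of the transition maps of W *)

Section WSmooth.
Context {R : realType} {n k m : nat} {Y : topologicalType}
  {AY : set (chart R Y n.+1)} {cod : Y -> nat} {Q : 'I_k -> set Y}
  {F : 'I_m -> set Y} {lam : 'I_m -> Z2 n} {eta : principal_bundle n Y}.
Hypothesis FS : face_simple Smooth AY cod Q F.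
Local Notation E := (Defs.total eta).
Local Notation WW := (W cod F lam eta).
Local Notation pi := (@W_pi n m Y cod F lam eta).
Local Notation wdata := (@wdata R n k m Y AY Q F lam eta).

Lemma Y_transition c c' : AY c -> AY c' -> regular_in_charts Smooth c c' (@idfun Y).
Proof. by have [[[_ _ [_ _ H] _] _] _ _ _ _] := FS; exact: H. Qed.

Context (D D' : wdata) (e0 : E).
Hypothesis De0 : wdom_total D e0.
Hypothesis De0' : wdom_total D' e0.
Local Notation c := (cchart D).
Local Notation c' := (cchart D').
Local Notation tau := (tperm ord0 (cq D)).
Local Notation tau' := (tperm ord0 (cq D')).
Local Notation y0 := (eta e0).
Local Notation u0 := (wcoord D e0).

(** Smoothness at [e0] of a single coordinate. Coordinates are treated one at a time because the
    argument depends on whether the new one is unreflected, nonzero or zero at [e0]. *)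
Definition coord_extension (f : E -> R) : Prop :=
  exists (V : set 'rV[R]_n.+1) (g : 'rV[R]_n.+1 -> R),
    [/\ open V, V u0, smooth V g &
        forall e, wdom_total D e -> wdom_total D' e -> V (wcoord D e) ->
          g (wcoord D e) = f e].

(** A formula for the coordinate may depend on a choice of sign that is valid only near [pi e0] in
    [W]; the chart carries this restriction over to an open set of coordinates. *)
Lemma coord_extension_near (N : set WW) (V : set 'rV[R]_n.+1) g (f : E -> R) :
  nbhs (pi e0) N -> open V -> V u0 -> smooth V g ->
  (forall e, wdom_total D e -> wdom_total D' e -> V (wcoord D e) -> N (pi e) ->
     g (wcoord D e) = f e) -> coord_extension f.
Proof.
move=> Ne0 oV Vu0 Sg H.
have VN := nbhsI (open_nbhs_nbhs (conj oV Vu0)) (wchart_near FS De0 Ne0).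
set P := _ `&` _ in VN.
exists (interior P), g; split=> //; first exact: open_interior.
  by apply: smooth_in Sg => u /interior_subset[].
by move=> e De De' /interior_subset[Ve HN]; apply: H => //; exact: HN.
Qed.

Lemma wfold_u0 : wfold D u0 = c y0.
Proof. exact: (wfold_wcoord FS De0.1). Qed.

Lemma ytransition : exists (V : set 'rV[R]_n.+1) (g : 'rV[R]_n.+1 -> 'rV[R]_n.+1),
  [/\ open V, V (c y0), smooth_on V g &
    forall e, wdom_total D e -> wdom_total D' e -> V (wfold D (wcoord D e)) ->
      g (wfold D (wcoord D e)) = c' (eta e)].
Proof.
have [V [g [oV Vp Sg gE]]] :=
  Y_transition (cA D) (cA D') (cU_dom De0.1) (cU_dom De0'.1).
exists V, g; split=> // e [Ue _] [Ue' _]; rewrite (wfold_wcoord FS Ue) => Ve.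
by apply: gE => //; exact: cU_dom.
Qed.

Lemma wfold_open (V : set 'rV[R]_n.+1) : open V -> open (wfold D @^-1` V).
Proof.
by move/continuousP : (@wfold_continuous R n k m Y AY Q F lam eta D); exact.
Qed.

Lemma extension_unfolded i' : i' \notin cL D' ->
  coord_extension (fun e => wcoord D' e ord0 (tau' i')).
Proof.
move=> iL'; have [V [g [oV Vp Sg gE]]] := ytransition.
exists (wfold D @^-1` V), (fun u => g (wfold D u) ord0 i'); split.
- exact: wfold_open.
- by rewrite /= wfold_u0.
- exact: smooth_wfold oV ((smooth_onP _ _).1 Sg i').
- by move=> e De De' Ve; rewrite gE// wcoordE (negbTE iL').
Qed.

(** A nonzero reflected coordinate keeps its sign near [pi e0], and the square root is smooth on
    positive reals. *)
Lemma extension_interior i' : i' \in cL D' -> 0 < c' y0 ord0 i' ->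
  coord_extension (fun e => wcoord D' e ord0 (tau' i')).
Proof.
move=> iL' pos; have [V [g [oV Vp Sg gE]]] := ytransition.
have Sgi := (smooth_onP _ _).1 Sg i'.
pose V' := V `&` [set x | 0 < g x ord0 i'].
have oV' : open V'.
  rewrite openE => x [Vx gx]; apply: nbhsI; first exact: open_nbhs_nbhs.
  by have /cvgr_gt/(_ _ gx) := (Sgi 0%N).1 x Vx.
have gy0 : g (c y0) = c' y0 by rewrite -wfold_u0 gE// wfold_u0.
pose s := chi_sign D' i' (wphi D' e0).
have s2 : s * s = 1 by exact: chi_sign_sqr.
have De0w : chart_dom (wchart (cod := cod) D') (pi e0) by exact/(wchart_pi FS).
have [oD _ _ cw _] := (is_chartP _ _).1 (wchart_is_chart FS D').
have cj : wchart (cod := cod) D' w ord0 (tau' i') @[w --> pi e0] -->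
    wcoord D' e0 ord0 (tau' i').
  rewrite -(wchartE FS De0').
  apply: (@cvg_comp _ _ _ _ (fun x : 'rV[R]_n.+1 => x ord0 (tau' i')) _
    (nbhs (wchart (cod := cod) D' (pi e0)))); first exact: cw.
  exact: coord_continuous.
have cs : s * wchart (cod := cod) D' w ord0 (tau' i') @[w --> pi e0] -->
    s * wcoord D' e0 ord0 (tau' i').
  apply: (@cvgM _ _ (nbhs (pi e0)) (nbhs_filter _) (fun=> s)
    (fun w => wchart (cod := cod) D' w ord0 (tau' i'))); last exact: cj.
  exact: (@cst_continuous _ _ s (pi e0)).
have p0 : 0 < s * wcoord D' e0 ord0 (tau' i').
  by rewrite wcoordE iL' mulrA s2 mul1r sqrtr_gt0.
have /cvgr_gt/(_ _ p0) N1 := cs.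
apply: (coord_extension_near (V := wfold D @^-1` V')
  (g := fun u => s * Num.sqrt (g (wfold D u) ord0 i')) N1).
- exact: wfold_open.
- by rewrite /= wfold_u0; split; rewrite //= gy0.
- move=> N; apply: CkM; first exact: wfold_open.
    by apply: Ck_cst; exact: wfold_open.
  apply: Ck_sqrt; first exact: wfold_open.
    by move=> u [].
  apply: (smooth_wfold D (f := fun x => g x ord0 i') oV' _ N).
  by apply: smooth_in Sgi => x [].
- move=> e De De' [Ve _]; rewrite (wchartE FS De') gE// !wcoordE iL' => pe.
  congr (_ * _).
  have sg : 0 < s * chi_sign D' i' (wphi D' e).
    rewrite ltNge; apply/negP => sneg; move: pe; rewrite mulrA ltNge => /negP; apply.
    by rewrite mulr_le0_ge0// sqrtr_ge0.
  move: sg; rewrite /s /chi_sign.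
  case: (_ != 0); case: (_ != 0); rewrite /= ?expr1 ?expr0 ?mulr1 ?mul1r//;
    by rewrite ltrNr oppr0 ltr10.
Qed.

(** Across the wall the old and the new coordinate both change sign, so neither sign alone can be
    fixed. By [chi_wall] an isotropy element flips both or neither; their product [sg] is therefore
    well defined on the quotient, and requiring it to equal its value at [e0] gives an open set of
    [W]. *)
Lemma extension_wall i' : i' \in cL D' -> c' y0 ord0 i' = 0 ->
  coord_extension (fun e => wcoord D' e ord0 (tau' i')).
Proof.
move=> iL' p0'.
have [Uy0 Uy0'] := (De0.1, De0'.1).
have [f Hf _] := cHF iL'.
have Fy0 : F f y0 by rewrite -Hf; apply/c_wall => //; rewrite !inE iL' orbT.
have [i iL Hi] := cFH Uy0 Fy0.
have HH : cH D i = cH D' i' by rewrite Hi Hf.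
have wallE y : cU D y -> cU D' y -> c y ord0 i = 0 <-> c' y ord0 i' = 0.
  by move=> Uy Uy'; rewrite !c_wall ?HH// !inE ?iL ?iL' orbT.
have p0 : c y0 ord0 i = 0 by apply/wallE.
have nU : nbhs y0 (cU D) by apply: open_nbhs_nbhs; split=> //; exact: cU_open.
have nU' : nbhs y0 (cU D') by apply: open_nbhs_nbhs; split=> //; exact: cU_open.
have cs := wchart_spec_corner FS D; have cs' := wchart_spec_corner FS D'.
have [Dy Dy'] := (cU_dom Uy0, cU_dom Uy0').
have [B [h [oB Bp Sh hE]]] : exists (B : set 'rV[R]_n.+1) h,
    [/\ open B, B (c y0), smooth B h &
    \forall y \near y0, c' y ord0 i' = c y ord0 i * h (c y)].
  apply: (wall_quotient cs cs' (Y_transition (cA D) (cA D')) Dy Dy' p0).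
  by apply: filterS (nbhsI nU nU') => y [Uy Uy'] /wallE; exact.
have [B' [h' [oB' Bp' Sh' hE']]] : exists (B : set 'rV[R]_n.+1) h,
    [/\ open B, B (c' y0), smooth B h &
    \forall y \near y0, c y ord0 i = c' y ord0 i' * h (c' y)].
  apply: (wall_quotient cs' cs (Y_transition (cA D') (cA D)) Dy' Dy p0').
  by apply: filterS (nbhsI nU nU') => y [Uy Uy'] e; apply/wallE.
have hpos : 0 < h (c y0).
  exact: (wall_quotient_pos cs cs' Dy Dy' oB Bp Sh oB' Bp' Sh' hE hE').
pose V' := B `&` [set x | 0 < h x].
have oV' : open V'.
  rewrite openE => x [Bx hx]; apply: nbhsI; first exact: open_nbhs_nbhs.
  by have /cvgr_gt/(_ _ hx) := (Sh 0%N).1 x Bx.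
pose sg e := chi_sign D' i' (wphi D' e) * chi_sign D i (wphi D e).
pose O := [set w : WW | exists e, [/\ pi e = w, cU D (eta e), cU D' (eta e) & sg e = sg e0]].
have piO : pi @^-1` O = [set e | [/\ cU D (eta e), cU D' (eta e) & sg e = sg e0]].
  apply/seteqP; split=> [e [e1 [pe Ue Ue' <-]]|e [Ue Ue' se]]; last by exists e.
  have [_ _ _ _ eq] := w_triv D; have [_ _ _ _ eq'] := w_triv D'.
  have [ee [t [te st tc]]] := (W_piE FS _ Ue).1 pe.
  split; rewrite -?ee//; rewrite /sg te eq ?eq'// -?ee//.
  rewrite !chi_signD mulrACA.
  have -> : chi_sign D' i' t = chi_sign D i t.
    by rewrite /chi_sign (chi_wall FS Ue Ue' iL iL' HH st tc).
  by rewrite chi_sign_sqr mul1r.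
have oO : open O.
  apply/W_open; rewrite piO openE => e [Ue Ue' se].
  have [_ _ lc _ _] := w_triv D; have [_ _ lc' _ _] := w_triv D'.
  have nE (U : set Y) : open U -> U (eta e) -> nbhs e (eta @^-1` U).
    by move=> oU Ue1; apply: (@Defs.proj_continuous n Y eta); exact: open_nbhs_nbhs.
  have N1 := nbhsI (nE _ (cU_open D) Ue) (nE _ (cU_open D') Ue').
  have N2 := nbhsI (lc e Ue) (lc' e Ue').
  apply: filterS (nbhsI N1 N2) => e1 [[U1 U1'] [p1 p1']]; split=> //.
  by rewrite /sg p1 p1'.
have N0 : nbhs (pi e0) O by apply: open_nbhs_nbhs; split=> //; exists e0.
have N1 : nbhs (pi e0) _ := W_nbhs_proj hE.
apply: (coord_extension_near (V := wfold D @^-1` V')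
  (g := fun u => sg e0 * (u ord0 (tau i) * Num.sqrt (h (wfold D u)))) (nbhsI N0 N1)).
- exact: wfold_open.
- by rewrite /= wfold_u0.
- have oW := wfold_open oV'.
  move=> N; apply: CkM => //; first exact: Ck_cst.
  apply: CkM => //; first exact: smooth_coord.
  apply: Ck_sqrt => //; first by move=> u [].
  apply: (smooth_wfold D (f := h) oV' _ N).
  by apply: smooth_in Sh => x [].
- move=> e De De' [Be he] [Oe].
  have er : eta (repr (pi e)) = eta e.
    have : pi (repr (pi e)) = pi e by rewrite /W_pi reprK.
    by move=> /W_piP/asboolP[].
  rewrite /= er => ce.
  have : (pi @^-1` O) e by [].
  rewrite piO => -[_ _ <-].
  rewrite (wfold_wcoord FS De.1) !wcoordE iL iL' ce sqrtrM; last exact: (corner_ge0 FS _ De.1).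
  rewrite /sg !mulrA; congr (_ * _ * _).
  by rewrite -mulrA chi_sign_sqr mulr1.
Qed.

Lemma wtransition :
  exists (V : set 'rV[R]_n.+1) (g : 'rV[R]_n.+1 -> 'rV[R]_n.+1),
    [/\ open V, V u0, smooth_on V g &
        forall e, wdom_total D e -> wdom_total D' e -> V (wcoord D e) ->
          g (wcoord D e) = wcoord D' e].
Proof.
have H j : coord_extension (fun e => wcoord D' e ord0 j).
  rewrite -[j](tpermK ord0 (cq D')); set i' := tau' j.
  have [iL'|iL'] := boolP (i' \in cL D'); last exact: extension_unfolded.
  have := corner_ge0 FS i' De0'.1; rewrite le_eqVlt => /predU1P[/esym p0|pos].
    exact: extension_wall.
  exact: extension_interior.
have [V HV] := choice H; have [g Hg] := choice HV.
pose V0 := interior [set u | forall j, V j u].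
have sub j u : V0 u -> V j u by move=> /interior_subset; exact.
exists V0, (fun u => \row_j g j u); split.
- exact: open_interior.
- have Hn j : nbhs u0 (V j).
    by have [oV Vu _ _] := Hg j; exact: open_nbhs_nbhs.
  exact: (@filter_forall _ _ V _ (nbhs_filter u0) Hn).
- apply/smooth_onP => j N; have [_ _ Sg _] := Hg j.
  rewrite (_ : (fun _ => _) = g j); last by apply/funext => u; rewrite mxE.
  by apply: CkW (Sg N) => u; exact: sub.
- move=> e De De' Ve; apply/rowP => j; rewrite mxE.
  by have [_ _ _ ->] := Hg j => //; exact: sub.
Qed.

End WSmooth.
(** * The manifold W *)

Section WGlobal.
Context {R : realType} {r : regularity} {n k m : nat} {Y : topologicalType}
  {AY : set (chart R Y n.+1)} {cod : Y -> nat} {Q : 'I_k -> set Y}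
  {F : 'I_m -> set Y} {lam : 'I_m -> Z2 n} {eta : principal_bundle n Y}.
Hypothesis FS : face_simple r AY cod Q F.
Hypothesis IF : isotropy_function F lam.
Local Notation E := (Defs.total eta).
Local Notation WW := (W cod F lam eta).
Local Notation pi := (@W_pi n m Y cod F lam eta).
Local Notation wdata := (@wdata R n k m Y AY Q F lam eta).
Local Notation actW := (@W_act n m Y cod F lam eta).

Definition watlas : set (chart R WW n.+1) :=
  [set c | exists D : wdata, c = wchart (cod := cod) D].

Definition wshift (D : wdata) (s : Z2 n) : wdata :=
  WData (trivializes_shift s (w_triv D)).

(** Shifting the trivialization by [- phi e] gives [e] the label 0, which lies in the span of any
    isotropy vectors. *)
Lemma wcover e : exists D : wdata, wdom_total D e /\ wphi D e = 0.
Proof.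
have [U [phi [oU Ue tphi]]] := trivialization_exists eta (eta e).
have [D De DU] := corner_exists FS IF (open_nbhs_nbhs (conj oU Ue)).
exists (WData (trivializes_shift (- phi e) (trivializesS DU tphi))).
by rewrite /wdom_total /= subrr; split=> //; split=> //; exact: in_span0.
Qed.

Lemma W_projE e : eta (repr (pi e)) = eta e.
Proof.
have : pi (repr (pi e)) = pi e by rewrite /W_pi reprK.
by move=> /W_piP/asboolP[].
Qed.

Lemma W_compact : compact [set: WW].
Proof.
have [[_ cY] _ _ _ _] := FS.
have -> : [set: WW] = pi @` setT.
  by apply/seteqP; split=> // w _; have [e <-] := W_pi_surj w; exists e.
apply: continuous_compact; last exact: total_compact.
by apply: continuous_subspaceT; exact: W_pi_continuous.
Qed.

(** Points over different points of [Y] are separated there. Over the same point, labels in one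
    coset of the span put both in a common chart; labels in different cosets put them in two charts
    with disjoint domains, the second obtained by shifting the first. *)
Lemma W_hausdorff : hausdorff_space WW.
Proof.
have [[[hY _ _ _] _] _ _ _ _] := FS.
move=> p q; have [e <-] := W_pi_surj p; have [e' <-] := W_pi_surj q => clu.
have ee : eta e = eta e'.
  apply: hY => P P' Pe Pe'.
  have [w [wP wP']] := clu _ _ (W_nbhs_proj Pe) (W_nbhs_proj Pe').
  by exists (eta (repr w)).
have [D [De phi0]] := wcover e.
have nb (D1 : wdata) e1 : wdom_total D1 e1 ->
    nbhs (pi e1) (chart_dom (wchart (cod := cod) D1)).
  move=> De1; apply: open_nbhs_nbhs; split; first exact: (wchart_open FS).
  exact/(wchart_pi FS).
have [se|nse] := pselect (in_span D (wphi D e')); last first.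
  pose D' := wshift D (- wphi D e').
  have De' : wdom_total D' e'.
    split; rewrite /= -?ee; first exact: De.1.
    by rewrite subrr; exact: in_span0.
  have [w [[e1 [U1 s1] <-] [e2 [U2 s2] p12]]] := clu _ _ (nb _ _ De) (nb _ _ De').
  exfalso; apply: nse; move: s2; rewrite /= => s2.
  have U2' : cU D (eta e2) by [].
  have [_ s12 _] := (W_pi_phi FS _ U2').1 p12.
  rewrite (_ : wphi D e' = (wphi D e2 - wphi D e') + ((wphi D e2 - wphi D e1) + wphi D e1)).
    by apply: in_spanD => //; exact: in_spanD.
  by rewrite subrK addrAC Z2_addxx add0r Z2_oppE.
have De' : wdom_total D e' by split; rewrite -?ee//; exact: De.1.
apply: (wcoord_inj FS De De').
apply: (@norm_hausdorff R 'rV[R]_n.+1) => P P' Pe Pe'.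
have [_ _ _ cw _] := (is_chartP _ _).1 (wchart_is_chart FS D).
have cwe e1 P1 : wdom_total D e1 -> nbhs (wcoord D e1) P1 ->
    nbhs (pi e1) (wchart (cod := cod) D @^-1` P1).
  move=> De1; rewrite -(wchartE FS De1); apply: cw.
  exact/(wchart_pi FS).
have [w [wP wP']] := clu _ _ (cwe _ _ De Pe) (cwe _ _ De' Pe').
by exists (wchart (cod := cod) D w).
Qed.

(* Finitely many charts suffice, by compactness. *)
Lemma W_second_countable : @second_countable WW.
Proof.
have /choice[D HD] : forall w : WW, exists D : wdata, chart_dom (wchart (cod := cod) D) w.
  move=> w; have [e <-] := W_pi_surj w; have [D [De _]] := wcover e.
  by exists D; exact/(wchart_pi FS).
have [[w0 _]|nW] := pselect (exists w : WW, True); last first.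
  apply/second_countableP; exists (fun=> set0); split=> [_|x]; first exact: open0.
  by exfalso; apply: nW; exists x.
pose listed (s : seq WW) w := exists2 i, (i < size s)%N & nth w0 s i = w.
(* Finite lists ordered by inclusion of their entries: a property that holds eventually along this
   filter holds for some list, whose charts then cover [W]. *)
pose G := filter_from [set: seq WW] (fun s => [set s' | listed s `<=` listed s']).
have FG : Filter G.
  apply: filter_fromT_filter; first by exists [::].
  move=> s s'; exists (s ++ s') => s2 ss2; split=> w [i si iw]; apply: ss2.
    by exists i; rewrite ?size_cat ?ltn_addr// nth_cat si.
  exists (size s + i)%N; first by rewrite size_cat ltn_add2l.
  by rewrite nth_cat ltnNge leq_addr /= addKn.
have := (compact_near_coveringP _).1 W_compact _ G
  (fun s w => exists2 w', listed s w' & chart_dom (wchart (cod := cod) (D w')) w) FG.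
case.
  move=> w _; exists (chart_dom (wchart (cod := cod) (D w)),
      [set s' | listed [:: w] `<=` listed s']).
    split; last by exists [:: w].
    by apply: open_nbhs_nbhs; split; [exact: (wchart_open FS)|exact: HD].
  move=> [w' s] /= [Dw' ws]; exists w => //.
  by apply: ws; exists 0%N.
move=> S _ HS.
have SW w : exists2 w', listed S w' & chart_dom (wchart (cod := cod) (D w')) w.
  exact: (HS S (fun x => id) w Logic.I).
apply: (@atlas_second_countable R WW n.+1 1 (fun i => wchart (D (nth w0 S i)))).
  by move=> i; exact: (wchart_is_chart FS).
by move=> w; have [w' [i _ <-] ww'] := SW w; exists i.
Qed.

Lemma W_act_action : Defs.is_action actW.
Proof.
have [act0 actD] := tact_action eta.
split=> [w|s t w]; have [e <-] := W_pi_surj w; rewrite !W_actE ?act0//.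
by rewrite actD.
Qed.

Lemma W_act_continuous t : continuous (actW t).
Proof.
apply/continuousP => O /W_open oO; apply/W_open.
have -> : pi @^-1` (actW t @^-1` O) = tact t @^-1` (pi @^-1` O).
  by apply/seteqP; split=> e; rewrite /= W_actE.
by move/continuousP : (@tact_continuous n Y eta t); exact.
Qed.

Lemma wshift_dom (D : wdata) t e :
  wdom_total (wshift D t) e <-> wdom_total D (tact t e).
Proof.
have [_ _ _ _ eq] := w_triv D.
by rewrite /wdom_total /= proj_tact; split=> -[Ue]; rewrite eq// addrC.
Qed.

Lemma wshift_coord (D : wdata) t e : wdom_total D (tact t e) ->
  wcoord (wshift D t) e = wcoord D (tact t e).
Proof.
have [_ _ _ _ eq] := w_triv D.
move=> [Ue _]; rewrite proj_tact in Ue.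
by apply/rowP => j; rewrite !mxE /= proj_tact eq// [t + _]addrC.
Qed.

(** In charts, the action of [t] followed by [D'] is the chart of [wshift D' t], so this is a
    transition map. The case [t = 0] gives the compatibility of the atlas itself. *)
Lemma W_act_regular c c' t : watlas c -> watlas c' ->
  regular_in_charts r c c' (actW t).
Proof.
move=> [D ->] [D' ->]; case: r FS => // FSS w [e De <-].
rewrite W_actE => /(wchart_pi FSS)/wshift_dom De'.
have [V [g [oV Ve Sg gE]]] := wtransition FSS De De'.
exists V, g; split=> //; first by rewrite (wchartE FSS).
move=> _ [e1 De1 <-]; rewrite W_actE => /(wchart_pi FSS) De1'.
rewrite !(wchartE FSS)// => Ve1.
by rewrite gE// ?wshift_coord//; exact/wshift_dom.
Qed.

Lemma W_manifold : manifold r 1 watlas.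
Proof.
split; [exact: W_hausdorff|exact: W_second_countable|split].
- by move=> _ [D ->]; exact: (wchart_is_chart FS).
- move=> w; have [e <-] := W_pi_surj w; have [D [De _]] := wcover e.
  by exists (wchart D); [exists D|exact/(wchart_pi FS)].
- move=> c c' Ac Ac'; have := W_act_regular 0 Ac Ac'.
  have -> : actW 0 = idfun by apply/funext => w; have [-> //] := W_act_action.
  exact.
Qed.

Definition wpiece (j : 'I_k) : set WW := [set w | Q j (eta (repr w))].

Lemma wpiece_pi j e : wpiece j (pi e) <-> Q j (eta e).
Proof. by rewrite /wpiece /= W_projE. Qed.

Lemma wchart_piece (D : wdata) j w : chart_dom (wchart (cod := cod) D) w ->
  wpiece j w <-> wchart (cod := cod) D w ord0 ord0 = 0 /\ cH D (cq D) = Q j.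
Proof.
move=> [e De <-]; rewrite wpiece_pi (wchartE FS)// wcoord0.
have iq : cq D \in cq D |: cL D by rewrite setU11.
rewrite c_wall//; last exact: De.1.
split=> [Qe|[+ <-//]]; have HQ := cHQ De.1 Qe.
by rewrite HQ.
Qed.

Lemma wboundary : \bigcup_j wpiece j = boundary watlas.
Proof.
apply/seteqP; split=> [w [j _ Bw]|w [_ [[D ->] Dw c0]]].
  have [e pe] := W_pi_surj w; have [D [De _]] := wcover e.
  have Dw : chart_dom (wchart (cod := cod) D) w by rewrite -pe; exact/(wchart_pi FS).
  by exists (wchart D); split=> //; [exists D|exact: ((wchart_piece j Dw).1 Bw).1].
have [e De we] := Dw.
have [|j Hj] := cQH De.1.
  apply/c_wall; [exact: De.1|by rewrite setU11|].
  by rewrite -wcoord0 -(wchartE FS De) we.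
by exists j => //; apply/(wchart_piece _ Dw).
Qed.

Lemma wpiece_disjoint : trivIset setT wpiece.
Proof.
have [_ [_ dQ] _ _ _] := FS.
apply/trivIsetP => i j _ _ ij; apply/seteqP; split=> // w [wi wj].
by have /seteqP[+ _] := dQ _ _ ij; apply; split; [exact: wi|exact: wj].
Qed.

Lemma wpiece_closed j : closed (wpiece j).
Proof.
have [_ [fQ _] _ _ _] := FS; have cQ : closed (Q j).
  by have [y _ ->] := fQ j; exact: closed_closure.
rewrite -[wpiece j]setCK; apply: open_closedC; apply/W_open.
rewrite (_ : _ @^-1` _ = eta @^-1` (~` Q j)).
  by move/continuousP : (@Defs.proj_continuous n Y eta); apply; exact: closed_openC.
by apply/seteqP; split=> e /=; rewrite /wpiece /= W_projE.
Qed.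

Lemma wpiece_act j t w : wpiece j w -> wpiece j (actW t w).
Proof.
by have [e <-] := W_pi_surj w; rewrite W_actE => /wpiece_pi Qe; apply/wpiece_pi;
   rewrite proj_tact.
Qed.

(* An interior point of the facet [Q j] has trivial isotropy. *)
Lemma wpiece_effective j t : (forall w, wpiece j w -> actW t w = w) -> t = 0.
Proof.
have [_ [fQ _] _ _ _] := FS; have [y cy Qy] := fQ j.
have Qjy : Q j y by rewrite Qy; exact: face_at_self.
have [U [phi [oU Uy [_ su _ _ _]]]] := trivialization_exists eta y.
have [e ey _] := su y 0 Uy.
move=> /(_ (pi e)); rewrite W_actE => H.
have [D [De _]] := wcover e.
have Ue := De.1.
have /H/esym/(W_piE FS _ Ue)[_ [s [es ss sc]]] : wpiece j (pi e).
  by apply/wpiece_pi; rewrite ey.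
suff s0 : s = 0.
  have [act0 actD] := tact_action eta.
  by move: es; rewrite s0 act0 => /esym/tact_free.
rewrite ss big1// => i iL.
have HQ : cH D (cq D) = Q j by apply: (cHQ Ue); rewrite ey.
have qz : cchart D (eta e) ord0 (cq D) = 0.
  by apply/c_wall; rewrite ?setU11// HQ ey.
(* A reflected coordinate vanishing besides [cq D] would raise the codimension of [y] above 1. *)
rewrite sc ?scale0r//; apply/negP => iz.
have : (1 < cod (eta e))%N.
  rewrite (Y_codE FS (cA D) (cU_dom Ue)) num_zerosE (cardsD1 i) (cardsD1 (cq D)).
  rewrite !inE iz qz eqxx !andbT /=.
  by rewrite (_ : cq D != i)//; apply: contraNneq (cqL D) => ->.
by rewrite ey cy.
Qed.

End WGlobal.
(** * The boundary of W *)

Section SetType.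
Context {X : topologicalType} (B : set X).

Lemma set_val_open (O : set X) : open O -> open [set x : set_type B | O (set_val x)].
Proof. by move=> oO; exists O. Qed.

Lemma nbhs_set_val (x : set_type B) (N : set (set_type B)) : nbhs x N ->
  exists O, [/\ open O, O (set_val x) & forall y : set_type B, O (set_val y) -> N y].
Proof. by move=> [_ /= [[C oC <-] Cx CN]]; exists C. Qed.

Lemma set_type_mk (x : X) : B x -> exists y : set_type B, set_val y = x.
Proof. by move=> Bx; exists (SigSub (mem_set Bx)). Qed.

Lemma set_val_inj (x y : set_type B) : set_val x = set_val y -> x = y.
Proof. exact: val_inj. Qed.

Lemma set_valB (x : set_type B) : B (set_val x).
Proof. exact: set_valP. Qed.

Lemma set_val_continuous : continuous (set_val : set_type B -> X).
Proof. exact: initial_continuous. Qed.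

Lemma set_type_hausdorff : hausdorff_space X -> hausdorff_space (set_type B).
Proof.
move=> hX x y clu; apply: set_val_inj; apply: hX => P P' Px Py.
have [z [Pz P'z]] := clu _ _ (set_val_continuous Px) (set_val_continuous Py).
by exists (set_val z).
Qed.

Lemma set_type_second_countable : @second_countable X ->
  @second_countable (set_type B).
Proof.
move=> /second_countableP[U [oU bU]]; apply/second_countableP.
exists (fun i => [set x : set_type B | U i (set_val x)]); split=> [i|x N].
  exact: set_val_open.
move=> /nbhs_set_val[C [oC Cx CN]].
have [i [Ui UO]] := bU _ _ (open_nbhs_nbhs (conj oC Cx)).
by exists i; split=> // y /UO; exact: CN.
Qed.

Lemma set_type_compact : compact B -> compact [set: set_type B].
Proof.
move=> /compact_near_coveringP cB; apply/compact_near_coveringP => I G P FG HP.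
have HB x : B x -> \forall x' \near x & i \near G,
    forall b : set_type B, set_val b = x' -> P i b.
  move=> /set_type_mk[b bx].
  have [[A C]/= [Ab GC] AC] := HP b Logic.I.
  have [C1 [oC1 C1b C1A]] := nbhs_set_val Ab.
  exists (C1, C) => /=.
    by split=> //; rewrite -bx; exact: open_nbhs_nbhs.
  move=> [x' i] /= [Ox' Ci] b' bx'; apply: (AC (b', i)); split=> //=.
  by apply: C1A; rewrite bx'.
have := cB _ G (fun i x => forall b : set_type B, set_val b = x -> P i b) FG HB.
by apply: filterS => i Hi b _; exact: (Hi (set_val b) (set_valB b)).
Qed.

End SetType.

(** * A piece of the boundary as a closed manifold with action *)

Section Boundary.
Context {R : realType} {r : regularity} {n : nat} {X : topologicalType}
  {A : set (chart R X n.+1)} {act : Z2 n -> X -> X} {B : set X}.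
Hypothesis mX : manifold r 1 A.
Hypothesis cX : compact [set: X].
Hypothesis clB : closed B.
Hypothesis ractX : regular_action r A act.
Hypothesis actB : forall t x, B x -> B (act t x).
Hypothesis B0 : forall c x, A c -> chart_dom c x -> B x -> c x ord0 ord0 = 0.
Hypothesis BC : forall c x y, A c -> chart_dom c x -> B x -> chart_dom c y ->
  c y ord0 ord0 = 0 -> B y.

Definition zero_row (v : 'rV[R]_n) : 'rV[R]_n.+1 :=
  \row_i if unlift ord0 i is Some j then v ord0 j else 0.

Lemma zero_row0 v : zero_row v ord0 ord0 = 0.
Proof. by rewrite mxE unlift_none. Qed.

Lemma zero_rowK v : col' ord0 (zero_row v) = v.
Proof. by apply/rowP => j; rewrite !mxE liftK. Qed.

Lemma col'K (u : 'rV[R]_n.+1) : u ord0 ord0 = 0 -> zero_row (col' ord0 u) = u.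
Proof.
by move=> u0; apply/rowP => i; rewrite mxE; case: unliftP => [j ->|->];
   rewrite ?mxE.
Qed.

Lemma zero_row_continuous : continuous zero_row.
Proof.
move=> v; apply: continuous_rV => i.
rewrite [X in X @ _ --> _](_ : _ = fun v : 'rV[R]_n =>
  if unlift ord0 i is Some j then v ord0 j else 0); last first.
  by apply/funext => w; rewrite mxE.
rewrite mxE; case: (unlift ord0 i) => [j|]; first exact: coord_continuous.
exact: (@cst_continuous _ _ (0 : R)).
Qed.

Lemma col'_continuous : continuous (col' ord0 : 'rV[R]_n.+1 -> 'rV[R]_n).
Proof.
move=> v; apply: continuous_rV => j.
rewrite [X in X @ _ --> _](_ : _ = fun v : 'rV[R]_n.+1 => v ord0 (lift ord0 j)); last first.
  by apply/funext => w; rewrite mxE.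
by rewrite mxE; exact: coord_continuous.
Qed.

Lemma smooth_zero_row (V : set 'rV[R]_n.+1) f : open V -> smooth V f ->
  smooth (zero_row @^-1` V) (fun v => f (zero_row v)).
Proof.
move=> oV Sf N.
have oV' : open (zero_row @^-1` V).
  by move/continuousP : zero_row_continuous; exact.
apply: (@Ck_comp R _ _ N V _ zero_row (lift ord0) (fun=> id) (fun _ _ => 1)) => //.
- by move=> u _; exact: zero_row_continuous.
- move=> j h u; rewrite addrK; apply/rowP => i; rewrite !mxE eqxx /=.
  case: unliftP => [j' ->|->]; rewrite ?mxE ?eqxx /=.
    by rewrite (inj_eq lift_inj).
  by rewrite mulr0 addr0.
- by move=> j N'; exact: Ck_cst.
Qed.

(** By [B0] the piece maps into the hyperplane where coordinate 0 vanishes. By [BC] a chart that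
    meets the piece has no other boundary points, so the image is open in that hyperplane. *)
Lemma boundary_chartP c : A c -> is_chart 0 (boundary_chart B c).
Proof.
move=> Ac; have [_ _ [AC _ _]] := mX.
have [oD om ci cc cl] := (is_chartP _ _).1 (AC _ Ac).
have cval (x : set_type B) : chart_dom c (set_val x) ->
    c (set_val x) = zero_row (boundary_chart B c x).
  by move=> Dx; rewrite /= col'K// (B0 Ac Dx)//; exact: set_valB.
apply/is_chartP; split.
- exact: set_val_open.
- by [].
- move=> x y; rewrite !inE => Dx Dy e; apply: set_val_inj.
  by apply: ci; rewrite ?inE// !cval// e.
- move=> x Dx; apply: (@cvg_comp _ _ _ (fun x : set_type B => c (set_val x))
    (col' ord0) _ (nbhs (c (set_val x)))); last exact: col'_continuous.
  apply: (@cvg_comp _ _ _ set_val c _ (nbhs (set_val x))).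
    exact: set_val_continuous.
  exact: cc.
- move=> x N Dx /nbhs_set_val[C [oC Cx CN]].
  have := cl _ _ Dx (open_nbhs_nbhs (conj oC Cx)).
  rewrite (cval x Dx) => /zero_row_continuous.
  apply: (@filterS _ _ (nbhs_filter (boundary_chart B c x))) => v H _.
  have [|y [Oy Dy cy]] := H.
    move=> i i1; rewrite (_ : i = ord0) ?zero_row0//.
    by apply/val_inj; case: i i1 => [[]].
  have By : B y by apply: (BC Ac Dx (set_valB x) Dy); rewrite cy zero_row0.
  have [b by_] := set_type_mk By.
  exists b; rewrite /= by_; split=> //; last by rewrite cy zero_rowK.
  by apply: CN; rewrite by_.
Qed.

Lemma boundary_regular c c' (f : X -> X) (g : set_type B -> set_type B) :
  A c -> A c' -> (forall x, set_val (g x) = f (set_val x)) ->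
  regular_in_charts r c c' f ->
  regular_in_charts r (boundary_chart B c) (boundary_chart B c') g.
Proof.
move=> Ac Ac' gf; case: r => // H x Dx Dx'.
have cval (y : set_type B) : chart_dom c (set_val y) ->
    c (set_val y) = zero_row (boundary_chart B c y).
  by move=> Dy; rewrite /= col'K// (B0 Ac Dy)//; exact: set_valB.
have [|V [h [oV Vx Sh hE]]] := H (set_val x) Dx; first by rewrite -gf.
exists (zero_row @^-1` V), (fun v => col' ord0 (h (zero_row v))); split.
- by move/continuousP : zero_row_continuous; exact.
- by rewrite /= -[col' _ _]/(boundary_chart B c x) -cval.
- apply/smooth_onP => j.
  rewrite (_ : (fun _ => _) = fun v => h (zero_row v) ord0 (lift ord0 j)); last first.
    by apply/funext => v; rewrite mxE.
  apply: (smooth_zero_row (f := fun u => h u ord0 (lift ord0 j))) => //.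
  exact: ((smooth_onP _ _).1 Sh).
- move=> y Dy Dy' Vy; rewrite -cval// hE//=; first by rewrite gf.
    by rewrite -gf.
  by rewrite cval.
Qed.

(** Restriction to an invariant closed subset preserves everything except effectiveness, which
    therefore stays as a condition on [act] along [B]. *)
Lemma boundary_piece : exists actb : Z2 n -> set_type B -> set_type B,
  (forall t x, set_val (actb t x) = act t (set_val x)) /\
  ((forall t, (forall x, B x -> act t x = x) -> t = 0) ->
   two_torus_manifold r (boundary_atlas B A) actb).
Proof.
have /choice[actb Hact] : forall tx : Z2 n * set_type B,
    exists y : set_type B, set_val y = act tx.1 (set_val tx.2).
  by move=> [t x]; apply: set_type_mk; apply: actB; exact: set_valB.
exists (fun t x => actb (t, x)); split=> [t x|eff]; first exact: Hact.
have [hX sX [AC cov reg]] := mX; have [[act0 actD] actr] := ractX.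
split.
- split; first exact: set_type_hausdorff.
    exact: set_type_second_countable.
  split.
  + by move=> _ [c Ac <-]; exact: boundary_chartP.
  + move=> x; have [c Ac Dx] := cov (set_val x).
    by exists (boundary_chart B c) => //; exists c.
  + move=> _ _ [c Ac <-] [c' Ac' <-].
    by apply: (boundary_regular (f := idfun)) => //; exact: reg.
- apply: set_type_compact; exact: (subclosed_compact clB cX).
- split.
    split=> [x|s t x]; apply: set_val_inj; rewrite !Hact /= ?act0//.
  move=> t; split.
    move=> x N /nbhs_set_val[C [oC Cx CN]].
    have [cact _] := actr t.
    have : nbhs (set_val x) (act t @^-1` C).
      by apply: cact; apply: open_nbhs_nbhs; split=> //; rewrite -[act _ _](Hact (t, x)).
    move=> /(@set_val_continuous _ B); apply: (@filterS _ _ (nbhs_filter x)) => y Oy; apply: CN.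
    by rewrite Hact.
  move=> _ _ [c Ac <-] [c' Ac' <-].
  apply: (boundary_regular (f := act t)) => //.
  by have [_] := actr t; exact.
- move=> t H; apply: eff => x /set_type_mk[b <-].
  by rewrite -[LHS](Hact (t, b)) H.
Qed.

End Boundary.

Theorem lemma3p4 (R : realType) (r : regularity) (n k m : nat)
    (Y : topologicalType) (AY : set (chart R Y n.+1)) (cod : Y -> nat)
    (Q : 'I_k -> set Y) (F : 'I_m -> set Y) (lam : 'I_m -> Z2 n)
    (eta : principal_bundle n Y) :
  face_simple r AY cod Q F ->
  isotropy_function F lam ->
  exists A : set (chart R (W cod F lam eta) n.+1),
    Z2n_manifold_with_boundary r A (@W_act n m Y cod F lam eta) /\
    exists (N : nat) (B : 'I_N -> set (W cod F lam eta)),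
      [/\ trivIset setT B,
          \bigcup_i B i = boundary A &
          forall i, exists act : Z2 n -> set_type (B i) -> set_type (B i),
            (forall t x, set_val (act t x) = W_act t (set_val x)) /\
            two_torus_manifold r (boundary_atlas (B i) A) act].
Proof.
move=> FS IF; exists (@watlas R n k m Y AY cod Q F lam eta).
have mW := W_manifold FS IF (eta := eta).
have aW : regular_action r (@watlas R n k m Y AY cod Q F lam eta)
    (@W_act n m Y cod F lam eta).
  split; first exact: W_act_action.
  move=> t; split; first exact: W_act_continuous.
  by move=> c c' Ac Ac'; exact: (W_act_regular FS).
split; first by [].
(* One piece for each exceptional facet, namely the part of [W] above it; a piece may be
   disconnected. *)
exists k, (@wpiece n k m Y cod Q F lam eta); split.
- exact: (wpiece_disjoint FS).
- exact: (wboundary FS IF).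
move=> j; have [||||||actb [HE HT]] := @boundary_piece R r n _
  (@watlas R n k m Y AY cod Q F lam eta) (@W_act n m Y cod F lam eta)
  (@wpiece n k m Y cod Q F lam eta j) mW.
- exact: (W_compact FS).
- exact: (wpiece_closed FS).
- exact: aW.
- by move=> t x; exact: wpiece_act.
- by move=> c x [D ->] Dx /(wchart_piece FS _ Dx)[].
- move=> c x y [D ->] Dx /(wchart_piece FS _ Dx)[_ HQ] Dy cy.
  by apply/(wchart_piece FS _ Dy).
exists actb; split=> //; apply: HT => t H.
exact: (wpiece_effective FS IF H).
Qed.
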